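(* Let $C$ be a random vector in $\mathbb{R}_+^n$ satisfying the asymptotic homogeneity assumption (stated in the context) with exponent $\alpha$ and with $h$ of the form $h(x)=\gamma\prod_{i=1}^nx_i^{\alpha_i}$ for some $\gamma>0$ and exponents $\alpha_i>-1$ (so $\alpha=\sum_{i=1}^n\alpha_i$). Let $\Psi$ be a random element of $\mathcal{C}$ with distribution $\mu$, the weak limit as $K\to\infty$ of the distributions of $K^{\frac1{n+\alpha}}\min\{\ell_1,\dots,\ell_K\}$, where $\ell_1,\ell_2,\dots$ are independent copies of $\ell(p)=\langle C,p\rangle$, $p\in\overline{\Delta}_n$. Let $\pi_i=\frac{1+\alpha_i}{n+\alpha}$, so that $\pi=(\pi_1,\dots,\pi_n)\in\Delta_n$, and let $$M=\gamma\int_{R(\overline{e},1/n)}\prod_{i=1}^ny_i^{\alpha_i}\,dy=\int_{R(\overline{e},1/n)}h(y)\,dy>0.$$ Then for all $p\in\overline{\Delta}_n$, $$\mathbb{E}[\Psi(p)]=L\,p_1^{\pi_1}\cdots p_n^{\pi_n},\qquad\text{where } L=\Gamma\Big(\frac1{n+\alpha}+1\Big)\Big/M^{1/(n+\alpha)}.$$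
   Context: Let $n\ge2$, $\mathbb{R}_+^n:=(0,\infty)^n$, $\Delta_n:=\{p\in(0,1)^n:p_1+\cdots+p_n=1\}$, $\overline{\Delta}_n$ its closure, $\langle p,x\rangle=\sum_ip_ix_i$, $\overline{e}=(1/n,\dots,1/n)$, and $R(p,a):=\{x\in\mathbb{R}_+^n:\langle p,x\rangle<a\}$. $\Gamma$ is the gamma function. $\mathcal{C}:=\{\psi:\overline{\Delta}_n\to[0,\infty)\text{ continuous and concave}\}$ carries the (metrizable) topology of uniform convergence on compact subsets of $\Delta_n$ and its Borel $\sigma$-algebra. Asymptotic homogeneity assumption: $C=(C_1,\dots,C_n)$ has a joint density $\rho$ on $\mathbb{R}_+^n$, and there exist $\alpha\in\mathbb{R}$ and a non-negative measurable function $h$ on $\mathbb{R}_+^n$ with $\int_{\mathbb{R}_+^n}h(x)\,dx\in(0,\infty]$ such that $\lim_{\kappa\to0^+}\kappa^{-\alpha}\rho(\kappa x)=h(x)$ for $x\in\mathbb{R}_+^n$, uniformly for $x\in\Delta_n$. Under this assumption $\alpha>-n$ and the weak limit $\mu$ exists. *)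

(* Defs.v *)
From HB Require Import structures.
From mathcomp Require Import all_boot all_order all_algebra.
From mathcomp Require Import all_classical all_reals all_analysis.

Set Implicit Arguments.
Unset Strict Implicit.
Unset Printing Implicit Defensive.
Import Order.TTheory GRing.Theory Num.Theory numFieldNormedType.Exports.
Local Open Scope classical_set_scope.
Local Open Scope ring_scope.

(** R^n is ['rV[R]_n] with the product of the Borel sigma-algebras of [R]. *)

Definition measure_row_display : measure_display.
Proof. exact: default_measure_display. Qed.

Section measurable_row.
Context {R : realType} {n : nat}.

Let coord (i : 'I_n) (x : 'rV[R]_n) : R := x ord0 i.

Let row_set0 : g_sigma_preimage coord set0.
Proof. exact: sigma_algebra0. Qed.

Let row_setC A : g_sigma_preimage coord A -> g_sigma_preimage coord (~` A).
Proof. exact: sigma_algebraC. Qed.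

Let row_bigcup (F : (set 'rV[R]_n)^nat) :
  (forall i, g_sigma_preimage coord (F i)) ->
  g_sigma_preimage coord (\bigcup_i (F i)).
Proof. exact: sigma_algebra_bigcup. Qed.

HB.instance Definition _ := @isMeasurable.Build measure_row_display
  'rV[R]_n (g_sigma_preimage coord) row_set0 row_setC row_bigcup.

Lemma measurable_coord (i : 'I_n) :
  measurable_fun [set: 'rV[R]_n] (fun x => x ord0 i).
Proof.
move=> _ Y mY; rewrite setTI; apply: sub_sigma_algebra => /=.
rewrite -bigcup_seq/=; exists i => /=; first by rewrite mem_index_enum.
by exists Y => //; rewrite setTI.
Qed.

Lemma measurable_fun_row d (T : measurableType d) (f : T -> 'rV[R]_n) :
  (forall i, measurable_fun [set: T] (fun t => f t ord0 i)) ->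
  measurable_fun [set: T] f.
Proof.
move=> mf _ A mA; rewrite setTI.
pose H := [set B : set 'rV[R]_n | measurable (f @^-1` B)].
suff : H A by [].
apply: (smallest_sub _ _ mA).
  split.
  - by rewrite /H/= preimage_set0.
  - by move=> B HB; rewrite /H/= setTD preimage_setC; exact: measurableC.
  - by move=> F HF; rewrite /H/= preimage_bigcup; exact: bigcupT_measurable.
rewrite -bigcup_seq/= => B [i _ [Y mY <-]]; rewrite /H/= setTI.
by have := mf i measurableT Y mY; rewrite setTI.
Qed.

End measurable_row.

(** Lebesgue measure on R^n, by recursion on n: on R^0 it is the Dirac mass, on
R^(n+1) the product of the one-dimensional Lebesgue measure and of the Lebesgue
measure on R^n, carried over by [cons_row]. *)

Section lebesgue_row.
Context {R : realType}.
Local Open Scope ereal_scope.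

Definition cons_row n (x : measurableTypeR R * 'rV[R]_n) : 'rV[R]_n.+1 :=
  \row_i (if unlift ord0 i is Some j then x.2 ord0 j else x.1).

Lemma cons_row0 n x : @cons_row n x ord0 ord0 = x.1.
Proof. by rewrite mxE unlift_none. Qed.

Lemma cons_rowS n x (i : 'I_n) :
  @cons_row n x ord0 (lift ord0 i) = x.2 ord0 i.
Proof. by rewrite mxE liftK. Qed.

Lemma cons_rowK n (x : 'rV[R]_n.+1) :
  cons_row (x ord0 ord0, \row_i x ord0 (lift ord0 i)) = x.
Proof.
apply/rowP => i; case: (unliftP ord0 i) => [j|] ->.
  by rewrite cons_rowS mxE.
by rewrite cons_row0.
Qed.

Lemma measurable_cons_row n : measurable_fun setT (@cons_row n).
Proof.
apply: measurable_fun_row => i; case: (unliftP ord0 i) => [j|] ->.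
  apply: (eq_measurable_fun (fun x : measurableTypeR R * 'rV[R]_n =>
    x.2 ord0 j)) => [x _|]; first by rewrite cons_rowS.
  by apply: (measurableT_comp (measurable_coord j)); exact: measurable_snd.
apply: (eq_measurable_fun fst) => [x _|]; first by rewrite cons_row0.
exact: measurable_fst.
Qed.

Section cons_measure.
Context n (m : {sigma_finite_measure set 'rV[R]_n -> \bar R}).

Definition cons_measure : set 'rV[R]_n.+1 -> \bar R :=
  pushforward (lebesgue_measure \x m) (@cons_row n).

Let mcons A : measurable A -> measurable (@cons_row n @^-1` A).
Proof.
by move=> mA; rewrite -[X in measurable X]setTI; exact: measurable_cons_row.
Qed.

Let cons_measure0 : cons_measure set0 = 0.
Proof. by rewrite /cons_measure /pushforward preimage_set0 measure0. Qed.

Let cons_measure_ge0 A : 0 <= cons_measure A.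
Proof. by rewrite /cons_measure /pushforward measure_ge0. Qed.

Let cons_measure_sigma_additive : semi_sigma_additive cons_measure.
Proof.
move=> F mF tF mUF; rewrite /cons_measure /pushforward preimage_bigcup.
apply: measure_semi_sigma_additive.
- by move=> k; exact: mcons.
- apply/trivIsetP => /= i j _ _ ij; rewrite -preimage_setI.
  by move/trivIsetP : tF => /(_ _ _ _ _ ij) ->//; rewrite preimage_set0.
- by rewrite -preimage_bigcup; exact: mcons.
Qed.

HB.instance Definition _ := isMeasure.Build _ _ _ cons_measure
  cons_measure0 cons_measure_ge0 cons_measure_sigma_additive.

Let cons_measure_sigma_finite : sigma_finite setT cons_measure.
Proof.
have /sigma_finiteP[F [TF ndF Foo]] :=
  @sigma_finiteT _ _ _ (lebesgue_measure : set (measurableTypeR R) -> \bar R).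
have /sigma_finiteP[G [TG ndG Goo]] := sigma_finiteT m.
pose uncons (x : 'rV[R]_n.+1) : measurableTypeR R * 'rV[R]_n :=
  (x ord0 ord0, \row_i x ord0 (lift ord0 i)).
have consK x : uncons (cons_row x) = x.
  case: x => a y; rewrite /uncons cons_row0; congr pair.
  by apply/rowP => i; rewrite mxE cons_rowS.
have muncons : measurable_fun setT uncons.
  apply/measurable_fun_pairP; split; first exact: measurable_coord.
  apply: measurable_fun_row => i.
  apply: (eq_measurable_fun (fun x : 'rV[R]_n.+1 => x ord0 (lift ord0 i))).
    by move=> x _; rewrite /= mxE.
  exact: measurable_coord.
exists (fun k => uncons @^-1` (F k `*` G k)).
  apply/esym/seteqP; split=> // x _.
  have : (uncons x).1 \in setT by rewrite in_setT.
  rewrite TF inE => -[i _ Fi].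
  have : (uncons x).2 \in setT by rewrite in_setT.
  rewrite TG inE => -[j _ Gj].
  exists (maxn i j) => //; split.
    by move: Fi; apply/subsetPset/ndF/leq_maxl.
  by move: Gj; apply/subsetPset/ndG/leq_maxr.
move=> k; have [mFk Fk] := Foo k; have [mGk Gk] := Goo k; split.
  rewrite -[X in measurable X]setTI; apply: muncons => //.
  exact: measurableX.
rewrite /cons_measure /pushforward.
rewrite (_ : _ @^-1` _ = F k `*` G k); last first.
  by apply/funext => x; rewrite -[in RHS](consK x).
by rewrite product_measure1E// lte_mul_pinfty// ge0_fin_numE.
Qed.

HB.instance Definition _ := Measure_isSigmaFinite.Build _ _ _ cons_measure
  cons_measure_sigma_finite.

End cons_measure.

Fixpoint lebesgue_row (n : nat) : {sigma_finite_measure set 'rV[R]_n -> \bar R} :=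
  match n with
  | 0 => \d_(0%R : 'rV[R]_0)
  | k.+1 => cons_measure (lebesgue_row k)
  end.

End lebesgue_row.
Arguments lebesgue_row R n : clear implicits.

Section simplex.
Context {R : realType} {n : nat}.
Implicit Types p x : 'rV[R]_n.

Definition orthant : set 'rV[R]_n := [set x | forall i, 0 < x ord0 i].

Definition simplex : set 'rV[R]_n :=
  [set p | (forall i, 0 < p ord0 i < 1) /\ \sum_i p ord0 i = 1].

Definition pairing p x : R := \sum_i p ord0 i * x ord0 i.

Definition barycenter : 'rV[R]_n := const_mx n%:R^-1.

Definition region p (a : R) : set 'rV[R]_n :=
  [set x | orthant x /\ pairing p x < a].

End simplex.
Arguments orthant R n : clear implicits.
Arguments simplex R n : clear implicits.
Arguments barycenter R n : clear implicits.

Definition closed_simplex (R : realType) (n : nat) : set 'rV[R]_n :=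
  closure (simplex R n).
Arguments closed_simplex : clear implicits.

(** [closed_simplex R n] is also used as a type, with the topology induced by
that of R^n; its elements are coerced to vectors by [\val]. *)

Section concave_space.
Context (R : realType) (n : nat).

Definition compact_in_simplex : set (closed_simplex R n) -> Prop :=
  fun A => compact A /\ (forall p, A p -> simplex R n (\val p)).

Definition concave_on_simplex (psi : closed_simplex R n -> R) :=
  forall (p q r : closed_simplex R n) (t : R), 0 <= t <= 1 ->
  \val r = t *: \val p + (1 - t) *: \val q ->
  t * psi p + (1 - t) * psi q <= psi r.

Definition concave_set :
    set {family compact_in_simplex, closed_simplex R n -> R} :=
  [set psi | [/\ continuous (psi : closed_simplex R n -> R),
    concave_on_simplex psi & forall p, 0 <= psi p]].

(** The space C, with the topology induced by that of uniform convergence on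
the compact subsets of the open simplex. *)
Definition concave_space : Type := concave_set.

HB.instance Definition _ := Uniform.copy concave_space concave_set.

Definition concave_fun (psi : concave_space) : closed_simplex R n -> R :=
  set_val psi.

Lemma concave_set0 : concave_set (fun=> 0).
Proof.
split=> //; first by exact: cst_continuous.
by move=> p q r t _ _; rewrite !mulr0 addr0.
Qed.

HB.instance Definition _ :=
  isPointed.Build concave_space (SigSub (mem_set concave_set0)).

End concave_space.

Definition borel (T : ptopologicalType) := g_sigma_algebraType (@open T).

Section normalized_min.
Context (R : realType) (n : nat).
Implicit Types (p q r : closed_simplex R n) (c : nat -> 'rV[R]_n) (K : nat).

Lemma closed_simplex_ge0 p i : 0 <= (\val p) ord0 i.
Proof.
have cl : closed [set x : 'rV[R]_n | 0 <= x ord0 i].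
  apply: (@preimage_closed _ _ (fun x : 'rV[R]_n => x ord0 i) [set y | 0 <= y]).
    by move=> x _; exact: coord_continuous.
  exact: closed_ge.
have : closed_simplex R n (\val p) by exact: set_valP.
move: (\val p) => {}p.
rewrite /closed_simplex closureEbigcap => /(_ _ (conj cl _)); apply.
by move=> x [+ _] => /(_ i) /andP[/ltW].
Qed.

Lemma continuous_pairing (x : 'rV[R]_n) :
  continuous (fun y : 'rV[R]_n => pairing y x).
Proof.
apply: (@continuous_big _ _ +%R 0 xpredT (@add_continuous _)) => i _ y.
apply: (@cvgM _ _ _ (nbhs_filter y)); [exact: coord_continuous|exact: cvg_cst].
Qed.

Lemma closed_simplex_sum p : \sum_i (\val p) ord0 i = 1.
Proof.
pose f (y : 'rV[R]_n) := pairing y (const_mx 1).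
have fE y : f y = \sum_i y ord0 i.
  by apply: eq_bigr => i _; rewrite mxE mulr1.
have cl : closed (f @^-1` [set y | y = 1]).
  apply: preimage_closed; last exact: closed_eq.
  by move=> x _; exact: continuous_pairing.
have : closed_simplex R n (\val p) by exact: set_valP.
rewrite -fE; move: (\val p) => {}p; rewrite /closed_simplex closureEbigcap => /(_ _ (conj cl _)); apply.
by move=> x [_ <-]; rewrite /= fE.
Qed.

(** With [c k] the value of the k-th copy of the random vector [C] (k >= 0),
this is [s * min {l_1, ..., l_(K+1)}]. *)
Definition scaled_min (s : R) c K (p : closed_simplex R n) : R :=
  s * \big[Num.min/pairing (\val p) (c 0%N)]_(k < K.+1) pairing (\val p) (c k).

Lemma scaled_min_concave_set (s : R) c K : 0 <= s ->
  (forall k, orthant R n (c k)) -> @concave_set R n (scaled_min s c K).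
Proof.
move=> s0 c0; have pos p k : 0 <= pairing (\val p) (c k).
  by apply: sumr_ge0 => i _; rewrite mulr_ge0 ?closed_simplex_ge0// ltW// c0.
split.
- have cont k : continuous (fun p => pairing (\val p) (c k)).
    move=> p; apply: (@continuous_comp (closed_simplex R n) 'rV[R]_n R set_val
      (fun y => pairing y (c k)) p); first exact: initial_continuous.
    exact: continuous_pairing.
  move=> p; apply: (@cvgM _ _ _ (nbhs_filter p)); [exact: cvg_cst|move: p].
  elim: (index_enum _) => [|j l IH] p.
    under eq_fun do rewrite big_nil.
    by rewrite big_nil; exact: cont.
  under eq_fun do rewrite big_cons.
  rewrite big_cons; apply: (@continuous_min _ _ (fun p => pairing (\val p) (c j))
    (fun p => \big[Num.min/pairing (\val p) (c 0%N)]_(k <- l) pairing (\val p) (c k))).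
    exact: cont.
  exact: IH.
- move=> p q r t /andP[t0 t1] rE; rewrite /scaled_min !(mulrCA _ s) -mulrDr.
  apply: ler_wpM2l => //.
  have pairr k : t * pairing (\val p) (c k) + (1 - t) * pairing (\val q) (c k) =
      pairing (\val r) (c k).
    rewrite /pairing !mulr_sumr -big_split/=; apply: eq_bigr => i _.
    by rewrite rE !mxE [in RHS]mulrDl !mulrA.
  have t'0 : 0 <= 1 - t by rewrite subr_ge0.
  apply/bigmin_geP; split=> [|k _]; rewrite -pairr; apply: lerD;
    apply: ler_wpM2l => //.
  + exact: bigmin_le_id.
  + exact: bigmin_le_id.
  + exact: bigmin_le.
  + exact: bigmin_le.
- by move=> p; rewrite mulr_ge0//; apply/bigmin_geP; split.
Qed.

(** [K^(1/(n + alpha)) min {l_1, ..., l_K}] as an element of the space C; the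
index is shifted so that it is defined for all [K : nat]. *)
Definition normalized_min (alpha : R) c (c0 : forall k, orthant R n (c k)) K :
    concave_space R n :=
  SigSub (mem_set (scaled_min_concave_set K
    (powR_ge0 K.+1%:R (n%:R + alpha)^-1) c0)).

Lemma scaled_min_close (s d : R) c c' K p : 0 <= s ->
  (forall k i, (k <= K)%N -> `|c k ord0 i - c' k ord0 i| <= d) ->
  `|scaled_min s c K p - scaled_min s c' K p| <= s * d.
Proof.
move=> s0; wlog suff : c c' / (forall k i, (k <= K)%N ->
    `|c k ord0 i - c' k ord0 i| <= d) ->
    scaled_min s c K p - scaled_min s c' K p <= s * d.
  move=> H cc'; rewrite ler_norml lerNl opprB !H// => k i kK.
  by rewrite distrC cc'.
move=> cc'; rewrite /scaled_min -mulrBr; apply: ler_wpM2l => //.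
rewrite lerBlDl -lerBlDr.
have pcc' k : (k <= K)%N -> pairing (\val p) (c k) - d <= pairing (\val p) (c' k).
  move=> kK; rewrite lerBlDr -lerBlDl /pairing -sumrB.
  rewrite -[leRHS]mul1r -(closed_simplex_sum p) mulr_suml.
  apply: ler_sum => i _; rewrite -mulrBr ler_wpM2l ?closed_simplex_ge0//.
  exact: le_trans (ler_norm _) (cc' _ _ kK).
apply/bigmin_geP; split=> [|k _].
  apply: le_trans (pcc' 0%N _) => //; rewrite lerD2r; exact: bigmin_le_id.
apply: le_trans (pcc' k _); last by rewrite -ltnS.
by rewrite lerD2r; exact: bigmin_le.
Qed.

Lemma normalized_min_open alpha c (c0 : forall k, orthant R n (c k)) K
    (U : set (concave_space R n)) :
  open U -> U (normalized_min alpha c0 K) ->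
  exists m : nat, forall c' (c'0 : forall k, orthant R n (c' k)),
  (forall k i, (k <= K)%N -> `|c k ord0 i - c' k ord0 i| <= m.+1%:R^-1) ->
  U (normalized_min alpha c'0 K).
Proof.
move=> [V oV <-] /= Vc; apply: contrapT => /forallNP H.
have {}H m : exists c' : {c' : nat -> 'rV[R]_n | forall k, orthant R n (c' k)},
    (forall k i, (k <= K)%N ->
      `|c k ord0 i - proj1_sig c' k ord0 i| <= m.+1%:R^-1) /\
    ~ V (set_val (normalized_min alpha (proj2_sig c') K)).
  have /existsNP[c' /existsNP[c'0 /not_implyP[? ?]]] := H m.
  by exists (exist _ c' c'0).
have [g {}H] := choice H.
set s := K.+1%:R `^ (n%:R + alpha)^-1.
have s0 : 0 <= s by exact: powR_ge0.
pose F : nat -> {family @compact_in_simplex R n, closed_simplex R n -> R} :=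
  fun m => scaled_min s (proj1_sig (g m)) K.
have cvgF : F @ \oo --> (scaled_min s c K :
    {family @compact_in_simplex R n, closed_simplex R n -> R}).
  apply/fam_cvgP => A _ W /uniform_nbhs[E [entE EW]].
  move: entE; rewrite -entourage_ballE => -[e /= e0 ballE].
  have : (s * m.+1%:R^-1) @[m --> \oo] --> s * 0.
    by apply: cvgM; [exact: cvg_cst|exact: cvg_harmonic].
  rewrite mulr0 => /cvgrPdist_lt/(_ e e0); apply: filterS => m.
  rewrite sub0r normrN => sm; apply: EW => y _; apply: ballE.
  rewrite /ball/=; apply: le_lt_trans (le_lt_trans (ler_norm _) sm).
  by apply: scaled_min_close => //; have [] := H m.
have /cvgF : nbhs (scaled_min s c K :
    {family @compact_in_simplex R n, closed_simplex R n -> R}) V.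
  by apply: open_nbhs_nbhs; split.
move=> [N _ /(_ N)] /(_ (leqnn N)) VN.
by have [_] := H N; apply.
Qed.

Lemma measurable_normalized_min alpha d (T : measurableType d)
    (C : nat -> {mfun T >-> 'rV[R]_n}) (C0 : forall k w, orthant R n (C k w)) K :
  measurable_fun [set: T]
    (fun w => normalized_min alpha (C0^~ w) K : borel (concave_space R n)).
Proof.
refine (@measurability _ _ T (borel (concave_space R n)) _ _
  (@open (concave_space R n)) erefl _) => // _ [U oU <-].
rewrite setTI; set X := (fun w => normalized_min _ _ _).
pose box (q : {ffun 'I_K.+1 * 'I_n -> rat}) (m : nat) : set T :=
  [set w | forall k i, `|ratr (q (k, i)) - C k w ord0 i| <= m.+1%:R^-1].
pose good (q : {ffun 'I_K.+1 * 'I_n -> rat}) m :=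
  forall c (c0 : forall k, orthant R n (c k)),
  (forall (k : 'I_K.+1) i, `|ratr (q (k, i)) - c k ord0 i| <= m.+1%:R^-1) ->
  U (normalized_min alpha c0 K).
have -> : X @^-1` U =
    \bigcup_(qm : {ffun 'I_K.+1 * 'I_n -> rat} * nat)
      (if `[< good qm.1 qm.2 >] then box qm.1 qm.2 else set0).
  apply/seteqP; split=> [w Uw|w [[q m] _ /=]]; last first.
    by case: asboolP => // qm bw; exact: qm.
  have [m Hm] := normalized_min_open oU Uw.
  have m2 : 0 < m.*2.+2%:R^-1 :> R by rewrite invr_gt0.
  have dense (k : 'I_K.+1) i : exists y : rat,
      `|ratr y - C k w ord0 i| <= m.*2.+2%:R^-1.
    have : C k w ord0 i < C k w ord0 i + m.*2.+2%:R^-1 by rewrite ltrDl.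
    move=> /rat_in_itvoo[y]; rewrite in_itv/= => /andP[y1 y2]; exists y.
    by rewrite ger0_norm ?subr_ge0 ?ltW// ltrBlDl.
  have [g Hg] := choice (fun ki => dense ki.1 ki.2).
  exists ([ffun ki => g ki], m.*2.+1) => //=.
  case: asboolP => [_ k i|]; first by rewrite ffunE; exact: (Hg (k, i)).
  case=> c c0 Hc; apply: Hm => k i kK.
  have kK' : (k < K.+1)%N by [].
  have := Hc (Ordinal kK') i; rewrite ffunE/=.
  have := Hg (Ordinal kK', i); rewrite /= distrC => h1 h2.
  rewrite (le_trans (ler_distD (ratr (g (Ordinal kK', i))) _ _))//.
  rewrite (le_trans (lerD h1 h2))// [leLHS](_ : _ = m.+1%:R^-1)//.
  have -> : m.*2.+2%:R = m.+1%:R * 2 :> R by rewrite -natrM muln2.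
  by rewrite invfM [RHS]splitr.
apply: countable_bigcupT_measurable => // -[q m]/=; case: asboolP => // _.
rewrite (_ : box q m = \bigcap_(ki in [set: 'I_K.+1 * 'I_n])
    [set w | `|ratr (q ki) - C ki.1 w ord0 ki.2| <= m.+1%:R^-1]); last first.
  by apply/seteqP; split=> w /= H => [[k i] _|k i]; [exact: H|exact: (H (k, i))].
apply: fin_bigcap_measurable => // -[k i] _ /=.
have mC : measurable_fun [set: T]
    (fun w => `|ratr (q (k, i)) - C k w ord0 i| : R).
  apply: measurableT_comp => //; apply: measurable_realfun.measurable_funB => //.
  exact: (measurableT_comp (measurable_coord i)).
have := mC measurableT _ (measurable_itv `]-oo, m.+1%:R^-1]); rewrite setTI.
by rewrite set_itvE.
Qed.

End normalized_min.

Section min_process.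
Context (R : realType) (n : nat) (alpha : R).
Context d (T : measurableType d) (C : nat -> {mfun T >-> 'rV[R]_n}).
Variable C_orthant : forall k w, orthant R n (C k w).

Definition min_process (K : nat) (w : T) : borel (concave_space R n) :=
  normalized_min alpha (C_orthant^~ w) K.

HB.instance Definition _ K := isMeasurableFun.Build _ _ _ _ (min_process K)
  (measurable_normalized_min alpha C_orthant K).

End min_process.

Definition weakly_converges (R : realType) (T : ptopologicalType)
    (nu : nat -> probability (borel T) R) (mu : probability (borel T) R) :=
  forall f : T -> R, continuous f -> (exists M, forall x, `|f x| <= M) ->
  (\int[nu K]_x (f x)%:E)%E @[K --> \oo] --> (\int[mu]_x (f x)%:E)%E.

Definition same_distribution (R : realType) d1 (T1 : measurableType d1)
    (P1 : probability T1 R) d2 (T2 : measurableType d2) (P2 : probability T2 R)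
    d (U : measurableType d) (X : {RV P1 >-> U}) (Y : {RV P2 >-> U}) :=
  forall A, measurable A -> distribution P1 X A = distribution P2 Y A.

Definition independent_sequence (R : realType) d (T : measurableType d)
    (P : probability T R) d' (U : measurableType d')
    (X : nat -> {RV P >-> U}) :=
  forall (J : seq nat) (A : nat -> set U), uniq J ->
  (forall k, measurable (A k)) ->
  P (\bigcap_(k in [set` J]) (X k @^-1` A k)) =
  (\prod_(k <- J) P (X k @^-1` A k))%E.

Definition joint_density (R : realType) (n : nat) d (T : measurableType d)
    (P : probability T R) (C : {RV P >-> 'rV[R]_n}) (rho : 'rV[R]_n -> R) :=
  [/\ measurable_fun (orthant R n) rho,
    (forall x, orthant R n x -> 0 <= rho x) &
    forall A, measurable A -> A `<=` orthant R n ->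
      distribution P C A = (\int[lebesgue_row R n]_(x in A) (rho x)%:E)%E].

(** Only the values of [rho] and [h] on the orthant matter; the last clause is
uniform convergence on the open simplex. *)
Definition asymptotically_homogeneous (R : realType) (n : nat)
    (rho : 'rV[R]_n -> R) (alpha : R) (h : 'rV[R]_n -> R) :=
  [/\ measurable_fun (orthant R n) h,
    (forall x, orthant R n x -> 0 <= h x),
    (0 < \int[lebesgue_row R n]_(x in orthant R n) (h x)%:E)%E,
    (forall x, orthant R n x ->
      kappa `^ (- alpha) * rho (kappa *: x) @[kappa --> 0^'+] --> h x) &
    {uniform simplex R n,
      (fun kappa x => kappa `^ (- alpha) * rho (kappa *: x)) @ 0^'+ --> h}].

Definition Gamma (R : realType) (s : R) : R :=
  \int[lebesgue_measure]_(t in `]0, +oo[) (t `^ (s - 1) * expR (- t)).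

(* Main.v *)
Require Import Defs.
From HB Require Import structures.
From mathcomp Require Import all_boot all_order all_algebra.
From mathcomp Require Import all_classical all_reals all_analysis.
From mathcomp Require Import measurable_realfun ring lra.
Import Order.TTheory GRing.Theory Num.Theory numFieldNormedType.Exports.
Local Open Scope classical_set_scope.
Local Open Scope ring_scope.

(** Write b = n + alpha and h(x) = gamma x_1^a_1 ... x_n^a_n.  Comparing the
limits defining h at two proportional points shows that alpha is the sum of the
a_i ([homogeneity_exponent]), so b is the sum of the positive numbers 1 + a_i.

Fix p in the open simplex and let X_K be the value at p of the K-th normalized
minimum.  By independence P(X_K >= t) is a K-th power of
1 - P(<C, p> < eps) with eps = t K^(-1/b).  The substitution x = eps y gives
  eps^(-b) P(<C, p> < eps) = int_{R(p,1)} eps^(-alpha) rho(eps y) dy,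
and the right-hand side tends to int_{R(p,1)} h.  Uniform convergence on the
simplex is what permits dominated convergence: scaling y to the simplex bounds
the integrand by h(y) + |y|^alpha, where |y| is the sum of the coordinates, and
this is integrable on the bounded region R(p,1) because alpha > -n
([scaled_density_le], [cvg_integral_region_rho]).  The substitution
y_i = z_i / p_i evaluates the limit as c = M p_1^(-1-a_1) ... p_n^(-1-a_n)
([integral_region_power_law]).  Hence K P(<C, p> < eps) tends to c t^b, and
P(X_K >= t) tends to exp(- c t^b) ([cvg_min_process_tail]).

Evaluation at p is continuous on the space of concave functions, because {p} is
a compact subset of the open simplex.  It is unbounded, so weak convergence is
applied to its truncations min(psi(p), m), whose means are integrals of tails
over ]0, m] ([weak_limit_mean]).  Thus E[Psi(p)] is the integral of
exp(- c t^b) over t > 0, which equals Gamma(1/b + 1) c^(-1/b)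
([integral_expR_powR]); since c^(-1/b) = M^(-1/b) p_1^pi_1 ... p_n^pi_n, this is
the claimed value.

Evaluation at a boundary point p is not continuous for this topology, but
concavity gives (1 - s) psi(p) <= psi(r) for the interior point
r = (1 - s) p + s e, with e the barycenter.  The formula at r tends to 0 with s,
so E[Psi(p)] = 0, which is the claimed value because some p_i is 0. *)

Set Implicit Arguments.
Unset Strict Implicit.
Unset Printing Implicit Defensive.

(** * Lebesgue measure on R^n: dilations and iterated integrals *)

Section lebesgue_scale.
Context {R : realType}.
Local Open Scope ereal_scope.
Notation leb := (@lebesgue_measure R).

Definition dilation (c : R) : measurableTypeR R -> measurableTypeR R :=
  fun x => (c * x)%R.

Lemma measurable_dilation c : measurable_fun setT (dilation c).
Proof. exact: measurable_realfun.mulrl_measurable. Qed.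

(** Up to the factor c, the image of Lebesgue measure under [dilation c] has
the same values as Lebesgue measure on half-open intervals, and these values
determine it. *)
Lemma lebesgue_measure_dilation (c : R) (A : set (measurableTypeR R)) :
  (0 < c)%R -> measurable A ->
  leb (dilation c @^-1` A) = c^-1%:E * leb A.
Proof.
move=> c0 mA.
have ci0 : (0 <= c)%R by exact: ltW.
have -> : leb A = c%:E * leb (dilation c @^-1` A).
  have uniq := @lebesgue_measure_unique R
    (mscale (NngNum ci0) (pushforward leb (dilation c))).
  refine (uniq (measurable_dilation c) _ A mA) => _ [[a b] _ <-].
  change (leb `]a, b] = c%:E * leb (dilation c @^-1` `]a, b])).
  have -> : dilation c @^-1` `]a, b] =
    [set` `](c^-1 * a)%R, (c^-1 * b)%R]].
    apply/seteqP; split=> x; rewrite /= /dilation !in_itv/= => /andP[h1 h2].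
      by rewrite ltr_pdivrMl// h1 ler_pdivlMl.
    by rewrite -ltr_pdivrMl// h1 -ler_pdivlMl.
  rewrite !lebesgue_measure_itv/= !lte_fin ltr_pM2l ?invr_gt0//.
  case: ifPn => _; last by rewrite mule0.
  by rewrite -!EFinD -EFinM mulrBr !mulrA mulfV ?gt_eqF// !mul1r.
by rewrite muleA -EFinM mulVf ?gt_eqF// mul1e.
Qed.

Lemma ge0_integral_dilation (c : R) (f : R -> \bar R) : (0 < c)%R ->
  measurable_fun [set: R] f -> (forall x, 0 <= f x) ->
  \int[leb]_x f (c * x)%R = c^-1%:E * \int[leb]_x f x.
Proof.
move=> c0 mf f0.
have ci0 : (0 <= c^-1)%R by rewrite invr_ge0 ltW.
rewrite -[(c^-1)%R]/((NngNum ci0)%:num).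
rewrite -ge0_integral_mscale//.
rewrite -[LHS](@ge0_integral_pushforward _ _ _ _ R _
  (measurable_dilation c) leb setT f)//.
have eq_int := @eq_measure_integral _ _ _ setT (mscale (NngNum ci0) leb)
  (pushforward leb (dilation c)).
apply: (eq_int (measurable_dilation c)) => A mA _.
by rewrite /= /pushforward lebesgue_measure_dilation.
Qed.

End lebesgue_scale.

Section row_tonelli.
Context {R : realType}.
Local Open Scope ereal_scope.
Notation leb := (@lebesgue_measure R).

Definition row_scale n (c : 'I_n -> R) (x : 'rV[R]_n) : 'rV[R]_n :=
  \row_i (c i * x ord0 i)%R.

Lemma ge0_integral_lebesgue_rowS n (f : 'rV[R]_n.+1 -> \bar R) :
  measurable_fun [set: 'rV[R]_n.+1] f -> (forall x, 0 <= f x) ->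
  \int[lebesgue_row R n.+1]_x f x =
  \int[leb]_x \int[lebesgue_row R n]_y f (cons_row (x, y)).
Proof.
move=> mf f0.
have -> : \int[lebesgue_row R n.+1]_x f x =
  \int[lebesgue_measure \x lebesgue_row R n]_z (f \o @cons_row R n) z.
  exact: (@ge0_integral_pushforward _ _ _ _ R _ (@measurable_cons_row R n) _ setT f).
rewrite fubini_tonelli1 => [//||x]; last exact: f0.
exact: (measurableT_comp mf (@measurable_cons_row R n)).
Qed.

Lemma measurable_row_scale n (c : 'I_n -> R) :
  measurable_fun setT (row_scale c).
Proof.
apply: measurable_fun_row => i.
apply: (eq_measurable_fun (fun x : 'rV[R]_n => (c i * x ord0 i)%R)) => [x _|].
  by rewrite mxE.
exact: (measurableT_comp (measurable_realfun.mulrl_measurable (c i))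
  (measurable_coord i)).
Qed.

(** By induction on the dimension: the inner integral is rescaled by the
induction hypothesis, the outer one by [ge0_integral_dilation]. *)
Lemma ge0_integral_row_scale n (c : 'I_n -> R) (f : 'rV[R]_n -> \bar R) :
  (forall i, (0 < c i)%R) ->
  measurable_fun [set: 'rV[R]_n] f -> (forall x, 0 <= f x) ->
  \int[lebesgue_row R n]_x f (row_scale c x) =
  (\prod_i c i)^-1%:E * \int[lebesgue_row R n]_x f x.
Proof.
elim: n => [|n IH] in c f *.
  move=> _ mf f0; rewrite big_ord0 invr1 mul1e.
  by apply: eq_integral => x _; congr f; apply/rowP => -[].
move=> c0 mf f0.
have mfc : measurable_fun setT (f \o @cons_row R n).
  exact: (measurableT_comp mf (@measurable_cons_row R n)).
have mF := @measurable_fun_fubini_tonelli_F _ _ _ _ _ (lebesgue_row R n) _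
  mfc (fun _ => f0 _).
rewrite !ge0_integral_lebesgue_rowS//; last first.
  exact: (measurableT_comp mf (measurable_row_scale c)).
transitivity (\int[leb]_x ((\prod_i c (lift ord0 i))^-1%:E *
    \int[lebesgue_row R n]_y f (cons_row ((c ord0 * x)%R, y)))).
  apply: eq_integral => x _.
  rewrite -(IH (fun i => c (lift ord0 i))
    (fun y => f (cons_row ((c ord0 * x)%R, y))))//.
  - apply: eq_integral => y _; congr f; apply/rowP => i; rewrite !mxE/=.
    by case: (unliftP ord0 i) => [j|] ->; rewrite ?liftK ?unlift_none// mxE.
  - exact: (measurableT_comp mfc (pair1_measurable (c ord0 * x)%R)).
rewrite ge0_integralZl; last 4 first.
- by [].
- exact: (measurableT_comp mF (measurable_dilation (c ord0))).
- by move=> x _; exact: integral_ge0.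
- by rewrite lee_fin invr_ge0 prodr_ge0// => i _; exact/ltW.
rewrite (@ge0_integral_dilation R (c ord0)
  (fun x => \int[lebesgue_row R n]_y f (cons_row (x, y))))//; last first.
  by move=> x; exact: integral_ge0.
by rewrite muleA -EFinM big_ord_recl invfM mulrC.
Qed.

Lemma measurable_prod_coord n (g : 'I_n -> R -> R) :
  (forall i, measurable_fun setT (g i)) ->
  measurable_fun setT (fun x : 'rV[R]_n => (\prod_i g i (x ord0 i))%R).
Proof.
move=> mg; apply: measurable_prod => i _.
exact: (measurableT_comp (mg i) (measurable_coord i)).
Qed.

Lemma integral_row_prod n (g : 'I_n -> R -> R) (r : 'I_n -> R) :
  (forall i, measurable_fun setT (g i)) -> (forall i x, (0 <= g i x)%R) ->
  (forall i, \int[leb]_x (g i x)%:E = (r i)%:E) ->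
  \int[lebesgue_row R n]_x (\prod_i g i (x ord0 i))%:E = (\prod_i r i)%:E.
Proof.
elim: n => [|n IH] in g r *.
  move=> _ _ _; rewrite big_ord0.
  under eq_integral do rewrite big_ord0.
  (* On R^0 Lebesgue measure is a unit mass. *)
  rewrite -[LHS]/(\int[\d_(0%R : 'rV[R]_0)]_(x in setT) (cst 1%:E x)).
  by rewrite integral_cst//= diracT mule1.
move=> mg g0 gr; rewrite ge0_integral_lebesgue_rowS//; last 2 first.
- apply/measurable_EFinP; exact: (measurable_prod_coord mg).
- by move=> x; rewrite lee_fin prodr_ge0.
transitivity (\int[leb]_x ((\prod_i r (lift ord0 i))%:E * (g ord0 x)%:E)).
  apply: eq_integral => x _.
  rewrite -(IH (fun i => g (lift ord0 i)))// -ge0_integralZr//; last 3 first.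
  - apply/measurable_EFinP.
    exact: (measurable_prod_coord (fun i => mg (lift ord0 i))).
  - by move=> y _; rewrite lee_fin prodr_ge0.
  - by rewrite lee_fin.
  apply: eq_integral => y _; rewrite big_ord_recl cons_row0/= mulrC EFinM.
  by congr (_ * _)%E; congr EFin; apply: eq_bigr => i _; rewrite cons_rowS.
have r0 i : (0 <= r i)%R.
  by rewrite -lee_fin -gr integral_ge0// => x _; rewrite lee_fin.
rewrite ge0_integralZl//; last 3 first.
- by apply/measurable_EFinP; exact: mg.
- by move=> x _; rewrite lee_fin.
- by rewrite lee_fin prodr_ge0.
by rewrite gr -EFinM big_ord_recl mulrC.
Qed.

End row_tonelli.

Section power_integrals.
Context {R : realType}.
Notation leb := (@lebesgue_measure R).

(** For c < 0 the integrand is unbounded at 0, so the fundamental theorem of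
calculus is applied on [b / (k + 2), b] and k tends to infinity. *)
Lemma integral_powR_itv (b c : R) : 0 < b -> -1 < c ->
  (\int[leb]_(x in `]0%R, b]) (x `^ c)%:E)%E = (b `^ (c + 1) / (c + 1))%:E.
Proof.
move=> b0 c1.
have c10 : 0 < c + 1 by rewrite -ltrBlDr sub0r.
pose F (k : nat) := [set` `[b * k.+2%:R^-1, b]].
have bk0 k : 0 < b * k.+2%:R^-1 by rewrite mulr_gt0// invr_gt0.
have bkb k : b * k.+2%:R^-1 < b.
  by rewrite -[ltRHS]mulr1 ltr_pM2l// invf_lt1// ltr1n.
have UF : \bigcup_k F k = [set` `]0, b]].
  apply/seteqP; split=> [x [k _]|x]; rewrite /F/= !in_itv/= => /andP[x0 xb].
    by rewrite (lt_le_trans (bk0 k)).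
  have : 0 < x / b by rewrite divr_gt0.
  move=> /(ltr_add_invr) [k]; rewrite add0r => kx.
  exists k => //; rewrite /F/= in_itv/= xb andbT.
  rewrite mulrC -ler_pdivlMr// ltW// (le_lt_trans _ kx)// lef_pV2 ?posrE//.
  by rewrite ler_nat.
have dF (x : R) : 0 < x ->
    is_derive x (1 : R) (fun x => x `^ (c + 1) / (c + 1)) (x `^ c).
  move=> x0; have := is_derive1_powR (c + 1) x0 => dx.
  have -> : (x `^ c = (c + 1)^-1 *: ((c + 1) * x `^ (c + 1 - 1))).
    by rewrite addrK /GRing.scale/= mulrA mulVf ?gt_eqF// mul1r.
  have -> : (fun x => x `^ (c + 1) / (c + 1)) =
      ((c + 1)^-1 \*: (fun y : R => y `^ (c + 1))).
    by apply/funext => y; rewrite /= mulrC.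
  exact: is_deriveZ.
have cpow (r x : R) : 0 < x -> {for x, continuous (fun y : R => y `^ r)}.
  move=> x0; apply/differentiable_continuous/derivable1_diffP.
  by have [] := is_derive1_powR r x0.
have intF k : (\int[leb]_(x in F k) (x `^ c)%:E)%E =
    ((b `^ (c + 1) - (b * k.+2%:R^-1) `^ (c + 1)) / (c + 1))%:E.
  rewrite (@continuous_FTC2 _ _ (fun x => x `^ (c + 1) / (c + 1)))//.
  - by rewrite mulrBl EFinB.
  - apply: continuous_in_subspaceT => x; rewrite inE/= in_itv/= => /andP[bx _].
    by apply: cpow; exact: lt_le_trans bx.
  - have cF x : 0 < x -> {for x, continuous
        (fun x => x `^ (c + 1) / (c + 1))}.
      move=> x0; apply/differentiable_continuous/derivable1_diffP.
      by have [] := dF x x0.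
    split.
    + move=> x; rewrite in_itv/= => /andP[bx _].
      by have [] := dF x (lt_trans (bk0 k) bx).
    + by apply: cvg_at_right_filter; exact: cF.
    + by apply: cvg_at_left_filter; exact: cF.
  - move=> x; rewrite in_itv/= => /andP[bx _].
    by rewrite derive1E; have [_ ->] := dF x (lt_trans (bk0 k) bx).
have := @ge0_nondecreasing_set_cvg_integral _ (measurableTypeR R) R F
  (fun x => (x `^ c)%:E) leb.
rewrite UF => H; apply: (cvg_unique _ (H _ _ _ _)) => //.
- apply/nondecreasing_seqP => k; apply/subsetPset => x.
  rewrite /F/= !in_itv/= => /andP[kx ->]; rewrite andbT (le_trans _ kx)//.
  by rewrite ler_pM2l// lef_pV2 ?posrE// ler_nat.
- by move=> k; exact: measurable_itv.
- by move=> k; apply/measurable_EFinP; exact: measurable_funTS.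
- by move=> k x _; rewrite lee_fin powR_ge0.
rewrite (_ : (fun k => _) = (fun k => ((b `^ (c + 1) -
    (b * k.+2%:R^-1) `^ (c + 1)) / (c + 1))%:E)); last exact/funext/intF.
apply: cvg_EFin; first exact: nearW.
apply: cvgM; last exact: cvg_cst.
rewrite -[X in _ --> X]subr0; apply: cvgB; first exact: cvg_cst.
have /cvg_at_rightP := powR_cvg0 c10; apply; split=> //.
rewrite -[X in _ --> X](mulr0 b); apply: cvgM; first exact: cvg_cst.
by have := @cvg_harmonic R; rewrite -cvg_shiftS.
Qed.

End power_integrals.

(** * Power laws on regions of the orthant *)

Section row_sets.
Context {R : realType} {n : nat}.

Lemma measurable_row_setP (A : 'I_n -> set R) : (forall i, measurable (A i)) ->
  measurable [set x : 'rV[R]_n | forall i, A i (x ord0 i)].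
Proof.
move=> mA; rewrite (_ : [set _ | _] =
    \bigcap_(i in [set: 'I_n]) ((fun x : 'rV[R]_n => x ord0 i) @^-1` A i)).
  apply: fin_bigcap_measurable => // i _.
  by rewrite -[X in measurable X]setTI; exact: measurable_coord.
by apply/seteqP; split=> x /= xA i; [move=> _|]; exact: xA.
Qed.

Lemma measurable_orthant : measurable (orthant R n).
Proof.
apply: (measurable_row_setP (A := fun _ => [set x | 0 < x])) => i.
rewrite (_ : [set _ | _] = [set` `]0, +oo[]); first exact: measurable_itv.
by apply/seteqP; split=> x /=; rewrite in_itv/= andbT.
Qed.

Lemma measurable_pairing (p : 'rV[R]_n) : measurable_fun setT (pairing p).
Proof.
apply: measurable_sum => i.
apply: (measurableT_comp (measurable_realfun.mulrl_measurable (p ord0 i))).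
exact: measurable_coord.
Qed.

Lemma measurable_region (p : 'rV[R]_n) b : measurable (region p b).
Proof.
rewrite (_ : region p b = orthant R n `&` (pairing p @^-1` [set` `]-oo, b[])).
  apply: measurableI; first exact: measurable_orthant.
  rewrite -[X in measurable X]setTI; apply: measurable_pairing => //.
by apply/seteqP; split=> x /= [x0 xb]; split=> //; move: xb; rewrite in_itv.
Qed.

(** Boxes are the sets on which an integral of a product of powers factors;
regions are compared with them, from above and from below. *)
Definition box (b : R) : set 'rV[R]_n := [set x | forall i, 0 < x ord0 i <= b].

Lemma measurable_box b : measurable (box b).
Proof.
apply: (measurable_row_setP (A := fun _ => [set x | 0 < x <= b])) => i.
rewrite (_ : [set _ | _] = [set` `]0, b]]); first exact: measurable_itv.
by apply/seteqP; split=> x /=; rewrite in_itv/=.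
Qed.

Lemma measurable_prod_powR (e : 'I_n -> R) :
  measurable_fun setT (fun x : 'rV[R]_n => \prod_i x ord0 i `^ e i).
Proof. exact: (measurable_prod_coord (fun i => measurable_powR (e i))). Qed.

Lemma integral_box_prod_powR (b : R) (e : 'I_n -> R) :
  0 < b -> (forall i, -1 < e i) ->
  (\int[lebesgue_row R n]_(x in box b) (\prod_i x ord0 i `^ e i)%:E)%E =
  (\prod_i (b `^ (e i + 1) / (e i + 1)))%:E.
Proof.
move=> b0 e1; pose g i := (fun x : R => x `^ e i) \_ [set` `]0, b]].
rewrite -(@integral_row_prod _ _ g).
- rewrite integral_mkcond; apply: eq_integral => x _; rewrite patchE.
  case: ifPn => [|xb].
    rewrite inE => xb; congr EFin; apply: eq_bigr => i _.
    by rewrite /g patchE mem_set//= in_itv/=; exact: xb.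
  have [i xi] : exists i, ~ (0 < x ord0 i <= b).
    by apply/existsNP; move: xb; rewrite notin_setE.
  apply/esym; rewrite (bigD1 i)//= /g patchE memNset ?mul0r//=.
- by move=> i; apply/(measurable_restrictT _ _).1 => //; exact: measurable_funTS.
- by move=> i x; apply: restrict_ge0 => {}x _; exact: powR_ge0.
- move=> i; rewrite -(integral_powR_itv b0 (e1 i)) [RHS]integral_mkcond.
  by apply: eq_integral => x _; rewrite /g restrict_EFin.
Qed.

End row_sets.
Arguments box R n b : clear implicits.

Section row_scale.
Context {R : realType} {n : nat}.
Local Open Scope ereal_scope.

Lemma orthant_row_scale (c : 'I_n -> R) (x : 'rV[R]_n) :
  (forall i, (0 < c i)%R) -> orthant R n (row_scale c x) <-> orthant R n x.
Proof.
move=> c0; split=> [+ i|+ i] => /(_ i); rewrite mxE pmulr_rgt0//.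
Qed.

(** The change of variables x_i = c_i y_i, for an integral over a set. *)
Lemma ge0_integral_row_scale_set (c : 'I_n -> R) (D : set 'rV[R]_n)
    (f : 'rV[R]_n -> \bar R) :
  (forall i, (0 < c i)%R) -> measurable D -> measurable_fun D f ->
  (forall x, D x -> 0 <= f x) ->
  \int[lebesgue_row R n]_(x in D) f x =
  (\prod_i c i)%:E *
  \int[lebesgue_row R n]_(x in row_scale c @^-1` D) f (row_scale c x).
Proof.
move=> c0 mD mf f0; rewrite integral_mkcond [in RHS]integral_mkcond.
have -> : (fun x => f (row_scale c x)) \_ (row_scale c @^-1` D) =
    (fun x => (f \_ D) (row_scale c x)).
  by apply/funext => x; rewrite !patchE.
rewrite ge0_integral_row_scale//.
- rewrite muleA -EFinM mulfV ?mul1e// gt_eqF// prodr_gt0// => i _; exact: c0.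
- exact/(measurable_restrictT _ _).1.
- by move=> x; exact: erestrict_ge0.
Qed.

End row_scale.

Section region_integrals.
Context {R : realType} {n : nat}.
Implicit Types (p x : 'rV[R]_n) (e : 'I_n -> R).

Lemma region_sub_orthant p b : region p b `<=` orthant R n.
Proof. by move=> x []. Qed.

(** Each coordinate of a point of the region is less than b / p_i, because the
other terms of the pairing are positive. *)
Lemma region_sub_box p b : orthant R n p ->
  exists2 B, 0 < B & region p b `<=` box R n B.
Proof.
move=> p0; exists (1 + \sum_i `|b| / p ord0 i).
  by rewrite ltr_wpDr// sumr_ge0// => i _; rewrite divr_ge0// ltW.
move=> x [x0 xb] i; rewrite x0/=.
have xi : x ord0 i <= `|b| / p ord0 i.
  rewrite ler_pdivlMr// mulrC (le_trans _ (le_trans (ltW xb) (ler_norm b)))//.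
  rewrite /pairing (bigD1 i)//= lerDl sumr_ge0// => j _.
  by rewrite mulr_ge0// ltW.
rewrite (le_trans xi)// (bigD1 i)//= addrCA lerDl addr_ge0// sumr_ge0// => j _.
by rewrite divr_ge0// ltW.
Qed.

Lemma integrable_region_prod_powR p b e : orthant R n p ->
  (forall i, -1 < e i) ->
  (lebesgue_row R n).-integrable (region p b)
    (fun x => (\prod_i x ord0 i `^ e i)%:E).
Proof.
move=> p0 e1; have [B B0 pB] := region_sub_box b p0.
apply: (@integrableS _ _ _ _ (box R n B)) => //.
- exact: measurable_box.
- exact: measurable_region.
apply/integrableP; split.
  apply/measurable_EFinP; apply: measurable_funTS; exact: measurable_prod_powR.
under eq_integral => x _.
  rewrite gee0_abs ?lee_fin ?prodr_ge0//; last by move=> i _; exact: powR_ge0.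
  over.
by rewrite integral_box_prod_powR// ltry.
Qed.

(** Reduces the integrability of a power of the sum to that of a product of
powers.  A nonnegative power is bounded by its largest value on the box.  A
negative power of the sum is the product of its n-th parts, and in each of them
the sum may be replaced by a single coordinate. *)
Lemma sum_powR_le_prod (B alpha : R) x : (0 < n)%N -> 0 <= B ->
  box R n B x ->
  (\sum_i x ord0 i) `^ alpha <=
  ((n%:R * B) `^ Num.max alpha 0) * \prod_i x ord0 i `^ (Num.min alpha 0 / n%:R).
Proof.
move=> n0 B0 xB.
have x0 i : 0 < x ord0 i by have /andP[] := xB i.
have n0' : 0 < n%:R :> R by rewrite ltr0n.
have [a0|a0] := leP 0 alpha.
  rewrite mul0r [X in _ * X]big1 ?mulr1; last by move=> i _; rewrite powRr0.
  apply: ge0_ler_powR => //; rewrite ?nnegrE ?mulr_ge0 ?sumr_ge0//.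
    by move=> i _; exact: ltW.
  rewrite -[n in n%:R]card_ord -sum1_card natr_sum mulr_suml.
  by apply: ler_sum => i _; rewrite mul1r; have /andP[] := xB i.
rewrite powRr0 mul1r.
have -> : (\sum_i x ord0 i) `^ alpha =
    \prod_(i < n) (\sum_j x ord0 j) `^ (alpha / n%:R).
  rewrite prodr_const card_ord -powR_mulrn ?powR_ge0// -powRrM.
  by rewrite divfK// gt_eqF.
apply: ler_prod => i _; rewrite powR_ge0/=.
rewrite -(opprK (alpha / n%:R)) !(powRN _ (- _)) lef_pV2 ?posrE ?powR_gt0//; last first.
  rewrite (bigD1 i)//= ltr_wpDr// sumr_ge0// => j _; exact: ltW.
apply: ge0_ler_powR; rewrite ?nnegrE ?sumr_ge0//.
- by rewrite oppr_ge0 pmulr_lle0 ?invr_gt0// ltW.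
- by rewrite ltW.
- by move=> j _; rewrite ltW.
- by rewrite (bigD1 i)//= lerDl sumr_ge0// => j _; exact: ltW.
Qed.

Lemma integrable_region_sum_powR p b (alpha : R) : (0 < n)%N ->
  orthant R n p -> - n%:R < alpha ->
  (lebesgue_row R n).-integrable (region p b)
    (fun x => ((\sum_i x ord0 i) `^ alpha)%:E).
Proof.
move=> n0 p0 an; have [B B0 pB] := region_sub_box b p0.
have n0' : 0 < n%:R :> R by rewrite ltr0n.
have := @integrable_region_prod_powR p b (fun=> Num.min alpha 0 / n%:R) p0.
have e1 : -1 < Num.min alpha 0 / n%:R.
  by rewrite ltr_pdivlMr// mulN1r lt_min an/= oppr_lt0.
move=> /(_ (fun=> e1)) /(integrableZl (measurable_region p b)
  ((n%:R * B) `^ Num.max alpha 0)).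
apply: le_integrable.
- exact: measurable_region.
- apply/measurable_EFinP; apply: measurable_funTS.
  apply: (measurableT_comp (measurable_powR alpha)).
  by apply: measurable_sum => i; exact: measurable_coord.
- move=> x px; rewrite /= lee_fin ger0_norm ?powR_ge0// ger0_norm; last first.
    by rewrite mulr_ge0 ?powR_ge0 ?prodr_ge0// => i _; exact: powR_ge0.
  apply: sum_powR_le_prod => //; [exact: ltW|exact: pB].
Qed.

End region_integrals.

Section power_law.
Context {R : realType} {n : nat}.
Variables (gamma : R) (a : 'I_n -> R) (h : 'rV[R]_n -> R).
Hypothesis gamma_gt0 : 0 < gamma.
Hypothesis a_gtN1 : forall i, -1 < a i.
Hypothesis hE : forall x, orthant R n x -> h x = gamma * \prod_i x ord0 i `^ a i.
Implicit Types (p x : 'rV[R]_n).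

Lemma power_law_row_scale (c : 'I_n -> R) x : (forall i, 0 < c i) ->
  orthant R n x -> h (row_scale c x) = (\prod_i c i `^ a i) * h x.
Proof.
move=> c0 x0; rewrite !hE//; last exact/orthant_row_scale.
rewrite mulrCA -big_split/=; congr (_ * _); apply: eq_bigr => i _.
by rewrite mxE powRM// ltW.
Qed.

Lemma prod_powR_sum (c : R) (e : 'I_n -> R) : 0 < c ->
  \prod_i c `^ e i = c `^ (\sum_i e i).
Proof.
move=> c0; apply/esym; apply: (big_morph (powR c)) => [x y|].
  by rewrite powRD// (gt_eqF c0) implybT.
exact: powRr0.
Qed.

Lemma power_law_homogeneous (c : R) x : 0 < c -> orthant R n x ->
  h (c *: x) = c `^ (\sum_i a i) * h x.
Proof.
move=> c0 x0; rewrite -(prod_powR_sum _ c0) -power_law_row_scale//.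
by congr h; apply/rowP => i; rewrite !mxE.
Qed.

(** With f(kappa) = kappa^(-alpha) rho(kappa 1), the expression defining h at
the point 2 * 1 is 2^alpha f(2 kappa).  Hence h(2 * 1) = 2^alpha h(1), whereas
the formula for h gives h(2 * 1) = 2^(sum of the a_i) h(1). *)
Lemma homogeneity_exponent (rho : 'rV[R]_n -> R) (alpha : R) :
  asymptotically_homogeneous rho alpha h -> alpha = \sum_i a i.
Proof.
move=> [_ _ _ h_lim _].
pose one : 'rV[R]_n := const_mx 1.
have one0 : orthant R n one by move=> i; rewrite mxE.
have two0 : orthant R n (2 *: one) by move=> i; rewrite !mxE mulr1.
have /cvg_at_rightP lim1 := h_lim _ one0.
have /cvg_at_rightP lim2 := h_lim _ two0.
have cvg_inv : k.+1%:R^-1 @[k --> \oo] --> (0 : R) by exact: cvg_harmonic.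
have cvg_inv2 : (k.+1%:R^-1 * 2) @[k --> \oo] --> (0 : R).
  by rewrite -[X in _ --> X](mul0r 2); apply: cvgM => //; exact: cvg_cst.
have inv0 (k : nat) : 0 < k.+1%:R^-1 :> R by rewrite invr_gt0.
have inv2_0 (k : nat) : 0 < k.+1%:R^-1 * 2 :> R by rewrite mulr_gt0.
have lim_one := lim1 _ (conj inv2_0 cvg_inv2).
have lim_two := lim2 _ (conj inv0 cvg_inv).
have h1 : 0 < h one.
  by rewrite hE// mulr_gt0// prodr_gt0// => i _; rewrite powR_gt0// mxE.
have : h (2 *: one) = 2 `^ alpha * h one.
  apply: (cvg_unique _ lim_two) => //.
  rewrite (_ : (fun k => _) = (fun k : nat => 2 `^ alpha *
      ((k.+1%:R^-1 * 2) `^ (- alpha) * rho ((k.+1%:R^-1 * 2) *: one)))).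
    by apply: cvgM; [exact: cvg_cst|exact: lim_one].
  have e2 : 2 `^ alpha * 2 `^ (- alpha) = 1 :> R.
    by rewrite -powRD ?pnatr_eq0 ?implybT// subrr powRr0.
  apply/funext => k; rewrite scalerA powRM//.
  set u := _^-1 `^ _; set r := rho _.
  transitivity (2 `^ alpha * 2 `^ (- alpha) * (u * r)); first by rewrite e2 mul1r.
  ring.
rewrite power_law_homogeneous//.
move/(mulIf (lt0r_neq0 h1))/(congr1 (@ln R)); rewrite !ln_powR.
by move/(mulIf _) => ->//; rewrite gt_eqF// ln_gt0// ltr1n.
Qed.

Lemma integrable_region_power_law p b : orthant R n p ->
  (lebesgue_row R n).-integrable (region p b) (EFin \o h).
Proof.
move=> p0; apply: (eq_integrable (measurable_region p b)
    (fun x => (gamma%:E * (\prod_i x ord0 i `^ a i)%:E)%E)).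
  by move=> x; rewrite inE => -[x0 _]; rewrite /= hE.
apply: integrableZl; first exact: measurable_region.
exact: integrable_region_prod_powR.
Qed.

Lemma power_law_ge0 x : orthant R n x -> 0 <= h x.
Proof.
move=> x0; rewrite hE// mulr_ge0 ?(ltW gamma_gt0)// prodr_ge0// => i _.
exact: powR_ge0.
Qed.

(** All the regions [region p 1] are images of the standard corner of unit
size under coordinatewise scaling; this is that corner. *)
Lemma region_barycenterE x : (0 < n)%N ->
  region (barycenter R n) n%:R^-1 x <-> orthant R n x /\ \sum_i x ord0 i < 1.
Proof.
move=> n0; rewrite /region/= /pairing.
have -> : \sum_i barycenter R n ord0 i * x ord0 i = n%:R^-1 * \sum_i x ord0 i.
  by rewrite mulr_sumr; apply: eq_bigr => i _; rewrite mxE.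
by rewrite -[X in _ < X]mulr1 ltr_pM2l ?invr_gt0 ?ltr0n.
Qed.

Lemma orthant_barycenter : (0 < n)%N -> orthant R n (barycenter R n).
Proof. by move=> n0 i; rewrite /barycenter mxE invr_gt0 ltr0n. Qed.

(** The substitution x_i = z_i / p_i turns the pairing with p into the sum of
the coordinates; its Jacobian contributes the exponents -1, and h the exponents
- a_i. *)
Lemma integral_region_power_law p : (0 < n)%N -> orthant R n p ->
  (\int[lebesgue_row R n]_(x in region p 1) (h x)%:E)%E =
  ((\prod_i p ord0 i `^ (- (1 + a i)))%:E *
   \int[lebesgue_row R n]_(y in region (barycenter R n) n%:R^-1) (h y)%:E)%E.
Proof.
move=> n0 p0; have /integrableP[mh _] := integrable_region_power_law 1 p0.
have pi0 i : 0 < (p ord0 i)^-1 by rewrite invr_gt0.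
rewrite (@ge0_integral_row_scale_set _ _ (fun i => (p ord0 i)^-1))//; last 2 first.
- exact: measurable_region.
- by move=> x [x0 _]; rewrite lee_fin power_law_ge0.
have -> : row_scale (fun i => (p ord0 i)^-1) @^-1` region p 1 =
    region (barycenter R n) n%:R^-1.
  have pairE x : pairing p (row_scale (fun i => (p ord0 i)^-1) x) = \sum_i x ord0 i.
    by apply: eq_bigr => i _; rewrite mxE mulrA mulfV ?mul1r// gt_eqF.
  apply/seteqP; split=> x.
    move=> [/orthant_row_scale x0 x1]; apply/region_barycenterE => //.
    by split; [exact: x0|rewrite -pairE].
  move=> /region_barycenterE[]// x0 x1; split; first exact/orthant_row_scale.
  by rewrite pairE.
rewrite (eq_integral (fun x =>
    ((\prod_i (p ord0 i)^-1 `^ a i)%:E * (h x)%:E)%E)); last first.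
  by move=> x; rewrite inE => -[x0 _]; rewrite power_law_row_scale.
rewrite ge0_integralZl_EFin; last 4 first.
- exact: measurable_region.
- by move=> x [x0 _]; rewrite lee_fin power_law_ge0.
- by have /integrableP[] :=
    integrable_region_power_law n%:R^-1 (orthant_barycenter n0).
- by apply: prodr_ge0 => i _; exact: powR_ge0.
rewrite muleA -EFinM -big_split/=; congr (_%:E * _)%E; apply: eq_bigr => i _.
rewrite -(powR_inv1 (ltW (p0 i))) -powRrM -powRD ?(gt_eqF (p0 i)) ?implybT//.
by rewrite mulN1r opprD.
Qed.

(** The region has the box of side 1 / (n + 1) as a subset, where the integral
is an explicit positive number. *)
Lemma power_law_mass_bounds : (0 < n)%N ->
  (0 < \int[lebesgue_row R n]_(y in region (barycenter R n) n%:R^-1) (h y)%:E < +oo)%E.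
Proof.
move=> n0; have ih := integrable_region_power_law n%:R^-1 (orthant_barycenter n0).
apply/andP; split; last first.
  apply: integrable_lty ih; exact: measurable_region.
have n1 : 0 < n.+1%:R^-1 :> R by rewrite invr_gt0.
apply: (@lt_le_trans _ _ (\int[lebesgue_row R n]_(y in box R n n.+1%:R^-1) (h y)%:E)%E).
  rewrite (eq_integral (fun x =>
      (gamma%:E * (\prod_i x ord0 i `^ a i)%:E)%E)); last first.
    move=> x; rewrite inE => xb; rewrite hE// => i.
    by have /andP[] := xb i.
  rewrite ge0_integralZl_EFin; last 4 first.
  - exact: measurable_box.
  - by move=> x _; rewrite lee_fin prodr_ge0// => i _; exact: powR_ge0.
  - by apply/measurable_EFinP; apply: measurable_funTS; exact: measurable_prod_powR.
  - exact: ltW.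
  rewrite integral_box_prod_powR// -EFinM lte_fin mulr_gt0// prodr_gt0// => i _.
  by rewrite divr_gt0 ?powR_gt0// -ltrBlDr sub0r.
apply: ge0_subset_integral.
- exact: measurable_box.
- exact: measurable_region.
- by have /integrableP[] := ih.
- by move=> x [x0 _]; rewrite lee_fin power_law_ge0.
move=> x xb; apply/region_barycenterE => //; split=> [i|].
  by have /andP[] := xb i.
apply: (@le_lt_trans _ _ (\sum_(i < n) n.+1%:R^-1)).
  by apply: ler_sum => i _; have /andP[] := xb i.
by rewrite sumr_const card_ord -[X in X < _]mulr_natl ltr_pdivrMr// mul1r ltr_nat.
Qed.

End power_law.

(** * Small-ball asymptotics of the density *)

Section small_ball.
Context {R : realType} {n : nat}.
Hypothesis n_ge2 : (2 <= n)%N.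
Variables (rho h : 'rV[R]_n -> R) (alpha : R).
Hypothesis alpha_gt : - n%:R < alpha.
Hypothesis mrho : measurable_fun (orthant R n) rho.
Hypothesis rho_ge0 : forall x, orthant R n x -> 0 <= rho x.
Hypothesis rho_h : asymptotically_homogeneous rho alpha h.
Hypothesis h_hom : forall c x, 0 < c -> orthant R n x ->
  h (c *: x) = c `^ alpha * h x.

Lemma orthant_scale (c : R) (x : 'rV[R]_n) : 0 < c -> orthant R n x ->
  orthant R n (c *: x).
Proof. by move=> c0 x0 i; rewrite mxE mulr_gt0. Qed.

Let n_gt0 : (0 < n)%N. Proof. exact: ltnW. Qed.

Lemma orthant_sum_gt0 (x : 'rV[R]_n) : orthant R n x -> 0 < \sum_i x ord0 i.
Proof.
move=> x0; rewrite (bigD1 (Ordinal n_gt0))//= ltr_pwDl// sumr_ge0// => j _.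
exact: ltW.
Qed.

Lemma orthant_simplex (p : 'rV[R]_n) : orthant R n p -> \sum_i p ord0 i = 1 ->
  simplex R n p.
Proof.
move=> p0 p1; split=> // i; rewrite p0/= -p1.
have [j ji] : exists j : 'I_n, j != i.
  have [i0|i0] := eqVneq (Ordinal n_gt0) i; last by exists (Ordinal n_gt0).
  by exists (Ordinal n_ge2); rewrite -i0.
rewrite (bigD1 i)//= (bigD1 j)//= ltrDl ltr_pwDl// sumr_ge0// => k _.
exact: ltW.
Qed.

Lemma normalize_simplex (x : 'rV[R]_n) : orthant R n x ->
  simplex R n ((\sum_i x ord0 i)^-1 *: x).
Proof.
move=> x0; have s0 := orthant_sum_gt0 x0; apply: orthant_simplex.
  by apply: orthant_scale => //; rewrite invr_gt0.
under eq_bigr do rewrite mxE.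
by rewrite -mulr_sumr mulVf// gt_eqF.
Qed.

(** Let s be the sum of the coordinates of x.  The left-hand side equals
s^alpha times (k s)^(-alpha) rho(k s u) with u = x / s in the simplex, and for
small k s the second factor is at most h(u) + 1, uniformly in u. *)
Lemma scaled_density_le : exists2 delta : R, 0 < delta &
  forall k x, 0 < k -> orthant R n x -> k * \sum_i x ord0 i < delta ->
  k `^ (- alpha) * rho (k *: x) <= h x + (\sum_i x ord0 i) `^ alpha.
Proof.
have [_ _ _ _ rho_unif] := rho_h.
have : nbhs (h : {uniform` simplex R n -> R})
    [set f : {uniform` simplex R n -> R} |
      forall x, simplex R n x -> `|h x - f x| < 1].
  apply/uniform_nbhs.
  exists [set xy : R * R | `|xy.1 - xy.2| < 1]; split => //.
  rewrite -entourage_ballE; exists 1 => //=.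
move=> /rho_unif [d /= d0 Hd]; exists d => // k x k0 x0 kd.
have s0 := orthant_sum_gt0 x0; set s := \sum_i x ord0 i in s0 kd *.
have ks0 : 0 < k * s by exact: mulr_gt0.
have := Hd (k * s); rewrite /= sub0r normrN gtr0_norm//.
move=> /(_ kd ks0 _ (normalize_simplex x0)).
rewrite -/s scalerA mulfK ?gt_eqF// distrC => /(le_lt_trans (ler_norm _)).
rewrite ltrBlDr => /ltW.
rewrite -(ler_pM2l (powR_gt0 alpha s0)) mulrDr mulr1 -h_hom//; last first.
  by apply: orthant_scale; rewrite ?invr_gt0.
rewrite scalerA mulfV ?gt_eqF// scale1r addrC; apply: le_trans.
have -> : k `^ (- alpha) = s `^ alpha * (k * s) `^ (- alpha).
  rewrite powRM ?ltW// mulrCA -powRD ?subrr ?powRr0 ?mulr1//.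
  by rewrite (gt_eqF s0) implybT.
by rewrite mulrA.
Qed.

Let measurable_rho_scale (k : R) : 0 < k ->
  measurable_fun (orthant R n) (fun x => rho (k *: x)).
Proof.
move=> k0; have -> : (fun x => rho (k *: x)) = rho \o row_scale (fun=> k).
  by apply/funext => x /=; congr rho; apply/rowP => i; rewrite !mxE.
apply: (measurable_comp (F := orthant R n)) => //.
- exact: measurable_orthant.
- by move=> _ [x x0 <-]; apply/orthant_row_scale.
- by apply: measurable_funTS; exact: measurable_row_scale.
Qed.

(** Dominated convergence.  The bound of [scaled_density_le] holds on the whole
region as soon as eps k is small, since the sum of the coordinates is bounded
there; the finitely many other k are dropped by a shift. *)
Lemma cvg_integral_region_rho (p : 'rV[R]_n) (eps : nat -> R) :
  orthant R n p -> (lebesgue_row R n).-integrable (region p 1) (EFin \o h) ->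
  (forall k, 0 < eps k) -> eps k @[k --> \oo] --> 0 ->
  (\int[lebesgue_row R n]_(x in region p 1)
      (eps k `^ (- alpha) * rho (eps k *: x))%:E)%E @[k --> \oo] -->
  (\int[lebesgue_row R n]_(x in region p 1) (h x)%:E)%E.
Proof.
move=> p0 ih eps0 cvg_eps.
have [mh h0 _ h_lim _] := rho_h.
have [d d0 Hd] := scaled_density_le.
have [B B0 pB] := region_sub_box 1 p0.
have sB x : region p 1 x -> \sum_i x ord0 i <= n%:R * B.
  move=> /pB xB; rewrite -[n in n%:R]card_ord -sum1_card natr_sum mulr_suml.
  by apply: ler_sum => i _; rewrite mul1r; have /andP[] := xB i.
have nB0 : 0 < n%:R * B by rewrite mulr_gt0// ltr0n.
have : \forall k \near \oo, eps k < d / (n%:R * B).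
  move/cvgrPdist_lt : cvg_eps => /(_ (d / (n%:R * B)) (divr_gt0 d0 nB0)).
  by apply: filterS => k; rewrite sub0r normrN gtr0_norm.
move=> [N _ HN]; rewrite -(cvg_shiftn N).
apply: (@dominated_cvg _ _ _ _ _ (measurable_region p 1) _ _
  (fun x => (h x + (\sum_i x ord0 i) `^ alpha)%:E)).
- move=> k; apply/measurable_EFinP; apply: measurable_funM => //.
  apply: (measurable_funS (measurable_orthant)); last exact: measurable_rho_scale.
  exact: region_sub_orthant.
- move=> x [x0 _]; apply: cvg_EFin; first exact: nearW.
  rewrite (cvg_shiftn N (fun k => eps k `^ (- alpha) * rho (eps k *: x))).
  by move/cvg_at_rightP : (h_lim x x0); apply; split.
- by [].
- exact: (integrableD (measurable_region p 1) ih
    (integrable_region_sum_powR 1 n_gt0 p0 alpha_gt)).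
- move=> k x px; have x0 := region_sub_orthant px.
  rewrite /= lee_fin ger0_norm; last first.
    by rewrite mulr_ge0 ?powR_ge0// rho_ge0//; exact: orthant_scale.
  apply: Hd => //; apply: le_lt_trans (ler_wpM2l (ltW (eps0 _)) (sB _ px)) _.
  by rewrite -ltr_pdivlMr//; apply: HN; exact: leq_addl.
Qed.

(** The region of size e is e times the region of size 1, and the factor e^n
of the substitution joins e^(-(n + alpha)). *)
Lemma integral_region_shrink (p : 'rV[R]_n) (e : R) : 0 < e ->
  (\int[lebesgue_row R n]_(x in region p 1)
      (e `^ (- alpha) * rho (e *: x))%:E)%E =
  ((e `^ (- (n%:R + alpha)))%:E *
   \int[lebesgue_row R n]_(x in region p e) (rho x)%:E)%E.
Proof.
move=> e0.
have scaleE (x : 'rV[R]_n) : row_scale (fun=> e) x = e *: x.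
  by apply/rowP => i; rewrite !mxE.
rewrite [X in (_ * X)%E](@ge0_integral_row_scale_set _ _ (fun=> e))//; last 3 first.
- exact: measurable_region.
- apply/measurable_EFinP; apply: (measurable_funS measurable_orthant _ mrho).
  exact: region_sub_orthant.
- by move=> x [x0 _]; rewrite lee_fin rho_ge0.
rewrite muleA -EFinM prodr_const card_ord -powR_mulrn ?ltW//.
rewrite -powRD ?(gt_eqF e0) ?implybT// opprD addrAC addNr add0r.
have -> : row_scale (fun=> e) @^-1` region p e = region p 1.
  apply/seteqP; split=> x; rewrite /= scaleE => -[x0 xe]; split.
  - by move=> i; have := x0 i; rewrite mxE pmulr_rgt0.
  - move: xe; rewrite /pairing; under eq_bigr do rewrite mxE mulrCA.
    by rewrite -mulr_sumr -[ltRHS]mulr1 ltr_pM2l.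
  - exact: orthant_scale.
  - rewrite /pairing; under eq_bigr do rewrite mxE mulrCA.
    by rewrite -mulr_sumr -[ltRHS]mulr1 ltr_pM2l.
rewrite [in RHS](eq_integral (fun x : 'rV[R]_n => (rho (e *: x))%:E)); last first.
  by move=> x _; rewrite scaleE.
rewrite -ge0_integralZl; last 4 first.
- exact: measurable_region.
- apply/measurable_EFinP.
  apply: (measurable_funS measurable_orthant) (measurable_rho_scale e0).
  exact: region_sub_orthant.
- by move=> x [x0 _]; rewrite lee_fin rho_ge0//; exact: orthant_scale.
- by rewrite lee_fin powR_ge0.
by apply: eq_integral => x _; rewrite EFinM.
Qed.

End small_ball.

(** * Tail integrals and the exponential limit *)

Section layer_cake.
Context d (T : measurableType d) (R : realType).
Local Open Scope ereal_scope.
Notation leb := (@lebesgue_measure R).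

Lemma measurable_fun_truth d' (U : measurableType d') (b : U -> bool) :
  measurable_fun setT b -> measurable [set x | b x].
Proof.
move=> mb; rewrite (_ : [set _ | _] = b @^-1` [set true]); last first.
  by apply/seteqP; split.
by rewrite -[X in measurable X]setTI; exact: mb.
Qed.

(** X(x) is the length of the interval ]0, X(x)], and the two integrations are
interchanged.  The tails carry weak inequalities so that the complement of
X >= t is the event pairing < e, to which the density applies. *)
Lemma ge0_integral_tail (mu : {sigma_finite_measure set T -> \bar R})
    (X : T -> R) :
  measurable_fun setT X -> (forall x, (0 <= X x)%R) ->
  \int[mu]_x (X x)%:E =
  \int[leb]_(t in `]0%R, +oo[) mu [set x | (t <= X x)%R].
Proof.
move=> mX X0.
pose S := [set z : T * measurableTypeR R | (0 < z.2 <= X z.1)%R].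
have mS : measurable S.
  apply: measurable_fun_truth; apply: measurable_and.
    exact: measurable_fun_ltr.
  apply: measurable_fun_ler => //.
  by apply: (measurableT_comp mX); exact: measurable_fst.
have tS (z : T * measurableTypeR R) : 0 <= (\1_S z)%:E :> \bar R by rewrite lee_fin.
transitivity (\int[mu]_x \int[leb]_t (\1_S (x, t))%:E).
  apply: eq_integral => x _.
  transitivity (\int[leb]_t (\1_(`]0%R, X x]) t)%:E).
    rewrite integral_indic//= setIT lebesgue_measure_itv/= lte_fin.
    case: ltP => [_|]; first by rewrite sube0.
    by move=> Xx; congr EFin; apply/eqP; rewrite eq_le Xx X0.
  apply: eq_integral => t _; rewrite !indicE.
  suff -> : ((x, t) \in S) = (t \in [set` `]0%R, X x]]) by [].
  by apply/idP/idP; rewrite !inE/= ?in_itv/=.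
rewrite (fubini_tonelli (fun z : T * measurableTypeR R => (\1_S z)%:E))//; last first.
  by apply/measurable_EFinP; exact: measurable_indic.
rewrite [RHS]integral_mkcond; apply: eq_integral => t _.
rewrite patchE; case: ifPn => [|]; rewrite mem_setE in_itv/= andbT => t0.
  transitivity (\int[mu]_x (\1_[set x | (t <= X x)%R] x)%:E).
    apply: eq_integral => x _; rewrite !indicE.
    suff -> : ((x, t) \in S) = (x \in [set x | (t <= X x)%R]) by [].
    by apply/idP/idP; rewrite !inE/= /S/= t0.
  rewrite integral_indic ?setIT//.
  by apply: measurable_fun_truth; exact: measurable_fun_ler.
apply: integral0_eq => x _; rewrite indicE memNset//= => -[/andP[]].
by rewrite (negbTE t0).
Qed.

Lemma ge0_integral_tail_min (mu : {sigma_finite_measure set T -> \bar R})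
    (X : T -> R) (m : R) : (0 <= m)%R ->
  measurable_fun setT X -> (forall x, (0 <= X x)%R) ->
  \int[mu]_x (Num.min (X x) m)%:E =
  \int[leb]_(t in `]0%R, m]) mu [set x | (t <= X x)%R].
Proof.
move=> m0 mX X0; rewrite ge0_integral_tail; last 2 first.
- exact: measurable_minr.
- by move=> x; rewrite le_min X0.
rewrite integral_mkcond [RHS]integral_mkcond; apply: eq_integral => t _.
rewrite !patchE !mem_setE !in_itv/= andbT.
have [t0|//] := ltP 0%R t; have [tm|mt] := leP t m => /=.
  rewrite (_ : [set _ | _] = [set x | (t <= X x)%R])//.
  by apply/seteqP; split=> x /=; rewrite le_min tm andbT.
rewrite (_ : [set _ | _] = set0) ?measure0//.
by rewrite -subset0 => x /=; rewrite le_min (leNgt t m) mt andbF.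
Qed.

End layer_cake.

Section exponential_limit.
Context {R : realType}.

(** Both bounds are ln (1 + y) <= y, for y = - x and for y = x / (1 - x), since
(1 - x)^-1 = 1 + x / (1 - x). *)
Lemma ln_onem_bounds (x : R) : 0 <= x < 1 -> - (x / (1 - x)) <= ln (1 - x) <= - x.
Proof.
move=> /andP[x0 x1]; have y0 : 0 < 1 - x by rewrite subr_gt0.
apply/andP; split; last by apply: le_ln1Dx; rewrite ltrN2.
rewrite lerNl -lnV ?posrE//.
rewrite [X in ln X](_ : _ = 1 + x / (1 - x)); last first.
  apply: (mulIf (lt0r_neq0 y0)).
  by rewrite mulVf ?lt0r_neq0// mulrDl mul1r divfK ?lt0r_neq0// subrK.
by apply: le_ln1Dx; rewrite (lt_le_trans (ltrN10 R))// divr_ge0// ltW.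
Qed.

(** In logarithmic form: (k + 1) ln (1 - x k) lies between
- (k + 1) x k / (1 - x k) and - (k + 1) x k by [ln_onem_bounds], and x k tends
to 0. *)
Lemma cvg_onem_expr (x : nat -> R) (l : R) :
  (forall k, 0 <= x k <= 1) -> (k.+1%:R * x k) @[k --> \oo] --> l ->
  (1 - x k) ^+ k.+1 @[k --> \oo] --> expR (- l).
Proof.
move=> x01 xl.
have x_0 : x k @[k --> \oo] --> 0.
  rewrite -[X in _ --> X](mul0r l).
  rewrite (_ : x = fun k => k.+1%:R^-1 * (k.+1%:R * x k)).
    by apply: cvgM => //; exact: cvg_harmonic.
  by apply/funext => k; rewrite mulKf.
have x_lt1 : \forall k \near \oo, x k < 1.
  move/cvgrPdist_lt : x_0 => /(_ 1 ltr01); apply: filterS => k.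
  by rewrite sub0r normrN; exact: le_lt_trans (ler_norm _).
have onem_x : (1 - x k)^-1 @[k --> \oo] --> (1 : R).
  rewrite -[X in _ --> X]invr1; apply: cvgV; rewrite ?oner_neq0//.
  rewrite -[X in _ --> X]subr0; apply: cvgB => //; exact: cvg_cst.
suff : k.+1%:R * ln (1 - x k) @[k --> \oo] --> - l.
  move=> /(continuous_cvg _ (@continuous_expR R (- l))).
  apply: cvg_trans; apply: near_eq_cvg; near=> k => /=.
  have xk1 : x k < 1 by near: k.
  by rewrite mulrC expRM_natr lnK// posrE subr_gt0.
have lo : - (k.+1%:R * x k * (1 - x k)^-1) @[k --> \oo] --> - l.
  by apply: cvgN; rewrite -[X in _ --> X]mulr1; exact: cvgM.
have hi : - (k.+1%:R * x k) @[k --> \oo] --> - l by exact: cvgN.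
apply: squeeze_cvgr; [|exact: lo|exact: hi]; near=> k.
have xk1 : x k < 1 by near: k.
have /ln_onem_bounds/andP[lnlo lnhi] : 0 <= x k < 1.
  by rewrite xk1 andbT; have /andP[] := x01 k.
by rewrite -mulrA -!(mulrN k.+1%:R); apply/andP; split; exact: ler_wpM2l.
Unshelve. all: by end_near. Qed.

End exponential_limit.

Section gamma_integral.
Context {R : realType}.
Notation leb := (@lebesgue_measure R).

Lemma integral_expR_itvcy (r b : R) : 0 < r ->
  (\int[leb]_(u in `[b, +oo[) (expR (- r * u))%:E)%E = (expR (- r * b) / r)%:E.
Proof.
move=> r0.
have ce : continuous (fun u : R => expR (- r * u)).
  move=> u; apply: continuous_comp; last exact: continuous_expR.
  by apply: cvgM; [exact: cvg_cst|exact: cvg_id].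
have dF (u : R) :
    is_derive u (1 : R) (fun u => - (expR (- r * u) / r)) (expR (- r * u)).
  (* The chain rule is stated for compositions, hence the explicit forms. *)
  have dm : is_derive u (1 : R) (fun v : R => - r *: v) (- r *: 1).
    exact: is_deriveZ.
  have de := is_derive1_comp (is_derive_expR (- r *: u)) dm.
  have -> : (fun u : R => - (expR (- r * u) / r)) =
      (- r^-1 \*: (expR \o (fun v : R => - r *: v))).
    by apply/funext => v; rewrite /GRing.scale /= [RHS]mulNr [in RHS]mulrC.
  have -> : expR (- r * u) = - r^-1 *: (expR (- r *: u) * (- r *: 1)).
    by rewrite /GRing.scale/= mulr1 mulrCA mulrNN mulVf ?mulr1// gt_eqF.
  exact: is_deriveZ.
have cF : continuous (fun u : R => - (expR (- r * u) / r)).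
  move=> u; apply: cvgN; apply: cvgM; [exact: ce|exact: cvg_cst].
rewrite (@ge0_continuous_FTC2y _ _ (fun u => - (expR (- r * u) / r)) _ 0).
- by rewrite sub0e -EFinN opprK.
- by move=> u _; exact: expR_ge0.
- by apply: continuous_subspaceT.
- rewrite -[X in _ --> X]oppr0 -[X in _ --> - X](mul0r r^-1).
  apply: cvgN; apply: cvgM; last exact: cvg_cst.
  rewrite (_ : (fun u => _) = (fun z => expR (- z)) \o (fun z => r * z)); last first.
    by apply/funext => u; rewrite /= mulNr.
  apply: (@cvg_comp _ _ _ _ _ _ (pinfty_nbhs R)); last exact: cvgr_expR.
  exact: gt0_cvgMry.
- by move=> u _; have [] := dF u.
- by apply: cvg_at_right_filter; exact: cF.
- by move=> u _; rewrite derive1E; have [_ ->] := dF u.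
Qed.

(** Half of the exponential decay absorbs the power: since ln y < y for
y = u / (2 a), one has u^a <= (2 a)^a exp(u / 2). *)
Lemma integral_powR_expR_lty (a : R) : 0 < a ->
  (\int[leb]_(u in `]0%R, +oo[) (u `^ a * expR (- u))%:E < +oo)%E.
Proof.
move=> a0.
pose C := (2 * a) `^ a.
apply: (@le_lt_trans _ _ (\int[leb]_(u in `[0%R, +oo[)
  (C%:E * (expR (- 2^-1 * u))%:E))%E); last first.
  rewrite ge0_integralZl_EFin; last 4 first.
  - by [].
  - by move=> u _; rewrite lee_fin expR_ge0.
  - apply/measurable_EFinP; apply: measurable_funTS.
    apply: (measurableT_comp (@measurable_expR R)).
    exact: measurable_realfun.mulrl_measurable.
  - exact: powR_ge0.
  by rewrite integral_expR_itvcy ?invr_gt0// -EFinM ltry.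
have mexp (r : R) : measurable_fun setT (fun u : R => expR (- r * u)).
  apply: (measurableT_comp (@measurable_expR R)).
  exact: measurable_realfun.mulrl_measurable.
apply: (@le_trans _ _ (\int[leb]_(u in `]0%R, +oo[)
  (C%:E * (expR (- 2^-1 * u))%:E))%E); last first.
  apply: ge0_subset_integral => //.
  - apply: measurable_funeM; apply/measurable_EFinP.
    exact: (measurable_funS measurableT _ (mexp 2^-1)).
  - by move=> u _; rewrite -EFinM lee_fin mulr_ge0 ?powR_ge0 ?expR_ge0.
  - by move=> u /=; rewrite !in_itv/= !andbT => /ltW.
apply: ge0_le_integral => //.
- by move=> u _; rewrite lee_fin mulr_ge0 ?powR_ge0 ?expR_ge0.
- apply/measurable_EFinP; apply: measurable_funM.
    by apply: measurable_funTS; exact: measurable_powR.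
  apply: measurable_funTS.
  by apply: eq_measurable_fun (mexp 1) => u _; rewrite mulN1r.
- apply: measurable_funeM; apply/measurable_EFinP.
  exact: (measurable_funS measurableT _ (mexp 2^-1)).
move=> u /=; rewrite in_itv/= andbT => u0.
rewrite -EFinM lee_fin.
have a2 : 0 < 2 * a by rewrite mulr_gt0.
have -> : u `^ a = C * (u / (2 * a)) `^ a.
  by rewrite -powRM ?divr_ge0 ?ltW// mulrC divfK ?gt_eqF.
rewrite -mulrA ler_wpM2l ?powR_ge0//.
have ua : 0 < u / (2 * a) by rewrite divr_gt0.
have -> : (u / (2 * a)) `^ a = expR (a * ln (u / (2 * a))).
  by rewrite /powR gt_eqF.
have : a * ln (u / (2 * a)) <= a * (u / (2 * a)).
  by rewrite ler_pM2l// ltW// ln_sublinear.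
have -> : a * (u / (2 * a)) = u / 2 by field; rewrite gt_eqF.
by move=> ln_le; rewrite -expRD ler_expR; lra.
Qed.

(** exp(- c t^b) is the integral of exp(- u) over u >= c t^b.  After exchanging
the integrations, u is integrated against the length (u / c)^(1/b) of the set of
those t, which gives the Gamma integral without a change of variables. *)
Lemma integral_expR_powR (c b : R) : 0 < c -> 0 < b ->
  (\int[leb]_(t in `]0%R, +oo[) (expR (- (c * t `^ b)))%:E)%E =
  (Gamma (b^-1 + 1) / c `^ b^-1)%:E.
Proof.
move=> c0 b0.
have bi0 : 0 < b^-1 by rewrite invr_gt0.
pose S := [set z : measurableTypeR R * measurableTypeR R |
  (0 < z.1) && (c * z.1 `^ b <= z.2)].
pose G (z : measurableTypeR R * measurableTypeR R) := (expR (- z.2) * \1_S z)%:E.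
have mS : measurable S.
  apply: measurable_fun_truth; apply: measurable_and.
    exact: measurable_fun_ltr.
  apply: measurable_fun_ler => //; apply: measurable_funM => //.
  exact: (measurableT_comp (measurable_powR b)).
have mG : measurable_fun setT G.
  apply/measurable_EFinP; apply: measurable_funM; last exact: measurable_indic.
  apply: (measurableT_comp (@measurable_expR R)).
  exact: (measurableT_comp (@oppr_measurable R setT)).
have G0 z : (0 <= G z)%E by rewrite lee_fin mulr_ge0 ?expR_ge0.
have mexp : measurable_fun setT (fun u : R => expR (- u)).
  apply: (measurableT_comp (@measurable_expR R)).
  exact: oppr_measurable.
transitivity (\int[leb]_t \int[leb]_u G (t, u))%E.
  rewrite integral_mkcond; apply: eq_integral => t _.
  rewrite patchE mem_setE in_itv/= andbT; case: ifPn => t0; last first.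
    apply/esym; apply: integral0_eq => u _.
    by rewrite /G indicE memNset ?mulr0// /S/= (negbTE t0).
  have := @integral_expR_itvcy 1 (c * t `^ b) ltr01.
  rewrite mulN1r divr1 => <-; rewrite integral_mkcond; apply: eq_integral => u _.
  rewrite patchE mem_setE in_itv/= andbT /G indicE.
  have -> : ((t, u) \in S) = (c * t `^ b <= u).
    by apply/idP/idP; rewrite inE /S/= t0.
  by case: ifPn => _; rewrite ?mulr1 ?mulr0// mulN1r.
rewrite (fubini_tonelli G)//.
transitivity (\int[leb]_(u in `]0%R, +oo[)
  ((c `^ b^-1)^-1%:E * (u `^ b^-1 * expR (- u))%:E))%E.
  rewrite [RHS]integral_mkcond; apply: eq_integral => u _.
  rewrite patchE mem_setE in_itv/= andbT; case: ifPn => u0; last first.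
    apply: integral0_eq => t _; rewrite /G indicE memNset ?mulr0// /S/=.
    move=> /andP[t0 tu]; move: u0; rewrite -leNgt => /(le_trans tu).
    by rewrite leNgt mulr_gt0// powR_gt0.
  transitivity (\int[leb]_t ((expR (- u))%:E *
      (\1_[set` `]0%R, (u / c) `^ b^-1]] t)%:E))%E.
    apply: eq_integral => t _; rewrite /G EFinM !indicE.
    suff -> : ((t, u) \in S) = (t \in [set` `]0, (u / c) `^ b^-1]]) by [].
    have powK (x : R) : 0 < x -> (x `^ b) `^ b^-1 = x.
      by move=> x0; rewrite -powRrM divff ?gt_eqF// powRr1// ltW.
    have powKV (x : R) : 0 < x -> (x `^ b^-1) `^ b = x.
      by move=> x0; rewrite -powRrM mulVf ?gt_eqF// powRr1// ltW.
    have uc0 : 0 < u / c by rewrite divr_gt0.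
    rewrite [RHS](_ : _ = (0 < t <= (u / c) `^ b^-1)); last first.
      by apply/idP/idP; rewrite inE/= ?in_itv.
    rewrite [LHS](_ : _ = (0 < t) && (c * t `^ b <= u)); last first.
      by apply/idP/idP; rewrite inE.
    case: ltP => //= t0; rewrite mulrC -ler_pdivlMr//; apply/idP/idP => [tu|tu].
      rewrite -(powK t t0); apply: ge0_ler_powR; rewrite ?nnegrE ?powR_ge0//.
      exact: ltW.
      exact: ltW.
    rewrite -(powKV (u / c) uc0); apply: ge0_ler_powR; rewrite ?nnegrE ?powR_ge0//.
      exact: ltW.
      exact: ltW.
  rewrite ge0_integralZl_EFin; last 4 first.
  - by [].
  - by move=> t _; rewrite lee_fin.
  - by apply/measurable_EFinP; exact: measurable_indic.
  - exact: expR_ge0.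
  rewrite integral_indic//= setIT lebesgue_measure_itv/= lte_fin powR_gt0 ?divr_gt0//.
  have cV : c^-1 `^ b^-1 = (c `^ b^-1)^-1.
    by rewrite -(powR_inv1 (ltW c0)) -powRrM mulN1r powRN.
  by rewrite sube0 -!EFinM powRM ?invr_ge0 ?ltW// cV; congr EFin; ring.
rewrite ge0_integralZl_EFin; last 4 first.
- by [].
- by move=> u _; rewrite lee_fin mulr_ge0 ?powR_ge0 ?expR_ge0.
- apply/measurable_EFinP; apply: measurable_funTS; apply: measurable_funM => //.
- by rewrite invr_ge0 powR_ge0.
rewrite /Gamma /Rintegral mulrC EFinM addrK; congr (_ * _)%E.
rewrite fineK// ge0_fin_numE; first exact: integral_powR_expR_lty.
by apply: integral_ge0 => u _; rewrite lee_fin mulr_ge0 ?powR_ge0 ?expR_ge0.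
Qed.

End gamma_integral.

(** * Means under weak convergence *)

Section weak_limit_mean.
Context {R : realType} {T : ptopologicalType}.
Notation leb := (@lebesgue_measure R).

Lemma measurable_borel_continuous (f : T -> R) :
  continuous f -> measurable_fun setT (f : borel T -> R).
Proof.
move=> /continuousP cf; apply: (measurability _ (RGenOInfty.measurableE R)) => //.
move=> /= _ [_ [x ->] <-]; rewrite setTI; apply: sub_sigma_algebra.
apply: cf; rewrite set_itvE; exact: open_gt.
Qed.

Lemma measurable_tail d (U : measurableType d) (P : probability U R) (X : U -> R) :
  measurable_fun setT X -> measurable_fun setT (fun t : R => P [set x | t <= X x]).
Proof.
move=> mX.
have mS t : measurable [set x | t <= X x].
  by apply: measurable_fun_truth; exact: measurable_fun_ler.
have -> : (fun t : R => P [set x | t <= X x]) =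
    EFin \o (fun t => fine (P [set x | t <= X x])).
  by apply/funext => t; rewrite /= fineK// fin_num_measure.
apply/measurable_EFinP; apply: nonincreasing_measurable => // s t st.
rewrite fine_le ?fin_num_measure// le_measure ?inE//.
by move=> x /=; exact: le_trans.
Qed.

Lemma cvg_integral_min d (U : measurableType d) (m : {measure set U -> \bar R})
    (X : U -> R) : measurable_fun setT X -> (forall x, 0 <= X x) ->
  (\int[m]_x (Num.min (X x) k%:R)%:E)%E @[k --> \oo] --> (\int[m]_x (X x)%:E)%E.
Proof.
move=> mX X0.
have -> : (\int[m]_x (X x)%:E =
    \int[m]_x limn (fun k => (Num.min (X x) k%:R)%:E))%E.
  apply: eq_integral => x _; apply/esym/cvg_lim => //; apply: cvg_EFin.
    exact: nearW.
  apply: cvg_near_cst; near=> k; apply/eqP; rewrite eq_minl//.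
  by near: k; exact: nbhs_infty_ger.
apply: cvg_monotone_convergence => //.
- by move=> k; apply/measurable_EFinP; exact: measurable_minr.
- by move=> k x _; rewrite lee_fin le_min X0/=.
- move=> x _ i j ij; rewrite lee_fin le_min ge_min lexx/= ge_min.
  by rewrite ler_nat ij orbT.
Unshelve. all: by end_near. Qed.

(** The truncations min(f, m) are bounded and continuous, and their means under
nu K are integrals over ]0, m] of tails at most 1, so dominated convergence
gives their means under mu; then m tends to infinity on both sides. *)
Lemma weak_limit_mean (nu : nat -> probability (borel T) R)
    (mu : probability (borel T) R) (f : T -> R) (G : R -> R) :
  weakly_converges nu mu -> continuous f -> (forall x, 0 <= f x) ->
  (forall t, 0 < t -> nu K [set x | t <= f x] @[K --> \oo] --> (G t)%:E) ->
  (\int[mu]_x (f x)%:E)%E = (\int[leb]_(t in `]0%R, +oo[) (G t)%:E)%E.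
Proof.
move=> nu_mu cf f0 nuG.
have mf := measurable_borel_continuous cf.
have mtail K : measurable_fun setT (fun t : R => nu K [set x | t <= f x]).
  exact: measurable_tail.
have mG : measurable_fun [set` `](0 : R), +oo[] (EFin \o G).
  apply: (emeasurable_fun_cvg (fun K (t : R) => nu K [set x | t <= f x])).
    by move=> K; exact: measurable_funTS.
  by move=> t /=; rewrite in_itv/= andbT; exact: nuG.
have sub0 (m : R) : [set` `]0, m]] `<=` [set` `](0 : R), +oo[].
  by move=> t /=; rewrite !in_itv/= => /andP[->].
have G0 t : 0 < t -> (0 <= (G t)%:E)%E.
  move=> /nuG Gt; rewrite -(cvg_lim _ Gt)//; apply: lime_ge.
    by apply/cvg_ex; eexists; exact: Gt.
  by apply: nearW => K; exact: measure_ge0.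
have trunc (k : nat) : (\int[mu]_x (Num.min (f x) k%:R)%:E =
    \int[leb]_(t in `]0%R, k%:R]) (G t)%:E)%E.
  have cmin : continuous (fun x => Num.min (f x) k%:R).
    move=> x; apply: (@continuous_min _ _ f (fun=> k%:R)); first exact: cf.
    exact: cst_continuous.
  have bmin : exists M, forall x, `|Num.min (f x) k%:R| <= M.
    exists k%:R => x; rewrite ger0_norm; last by rewrite le_min f0 ler0n.
    by rewrite ge_min lexx orbT.
  apply: cvg_unique (nu_mu _ cmin bmin) _ => //.
  rewrite (_ : (fun K => _) = (fun K =>
      \int[leb]_(t in `]0%R, k%:R]) nu K [set x | (t <= f x)%R])%E); last first.
    by apply/funext => K; exact: ge0_integral_tail_min.
  apply: (@dominated_cvg _ _ _ _ _ _ _ _ (cst 1%E)) => //.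
  - by move=> K; exact: (measurable_funS measurableT _ (mtail K)).
  - by move=> t /=; rewrite in_itv/= => /andP[t0 _]; exact: nuG.
  - apply/integrableP; split; first exact: measurable_cst.
    under eq_integral do rewrite /= normr1.
    rewrite (@integral_cst _ _ _ leb [set` `](0 : R), k%:R]] _ 1%E)//.
    rewrite mul1e /= lebesgue_measure_itv/=.
    by case: ifPn => _; rewrite ltry.
  - move=> K t _; rewrite gee0_abs//; apply: probability_le1.
    by apply: measurable_fun_truth; exact: measurable_fun_ler.
have cvgf := @cvg_integral_min _ (borel T) mu f mf f0.
apply: (cvg_unique _ cvgf) => //.
rewrite (_ : (fun k => _) = (fun k : nat =>
    \int[leb]_(t in `]0%R, k%:R]) (G t)%:E)%E); last exact/funext/trunc.
have -> : [set` `](0 : R), +oo[] = \bigcup_k [set` `](0 : R), k%:R]].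
  apply/seteqP; split=> [t /=|t [k _]]; last exact: sub0.
  rewrite in_itv/= andbT => t0; exists (Num.bound t) => //=.
  by rewrite in_itv/= t0 ltW// archi_boundP// ltW.
apply: ge0_nondecreasing_set_cvg_integral => //.
- move=> i j ij; apply/subsetPset => t /=; rewrite !in_itv/= => /andP[-> ti].
  by rewrite (le_trans ti)// ler_nat.
- by move=> k; apply: measurable_funS mG.
- by move=> k t /sub0/=; rewrite in_itv/= andbT; exact: G0.
Qed.

End weak_limit_mean.

Section evaluation.
Context {R : realType} {n : nat}.
Implicit Types (p : closed_simplex R n) (psi : concave_space R n).

Lemma concave_fun_concave_set psi : @concave_set R n (concave_fun psi).
Proof. by have := set_valP psi. Qed.

Lemma concave_fun_ge0 psi p : 0 <= concave_fun psi p.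
Proof. by have [_ _] := concave_fun_concave_set psi. Qed.

(** {p} belongs to the compact sets on which convergence is uniform. *)
Lemma continuous_evaluation p : simplex R n (\val p) ->
  continuous (fun psi => concave_fun psi p).
Proof.
move=> ps.
pose ev (g : {family @compact_in_simplex R n, closed_simplex R n -> R}) : R :=
  (g : closed_simplex R n -> R) p.
have cev (g : {family @compact_in_simplex R n, closed_simplex R n -> R}) :
    {for g, continuous ev}.
  have /fam_cvgP fam : nbhs g --> (g :
    {family @compact_in_simplex R n, closed_simplex R n -> R}) by [].
  have := fam [set p]; rewrite uniform_set1; apply; split.
    exact: compact_set1.
  by move=> _ ->.
move/continuousP : cev => cev.
apply/continuousP => A oA.
exact: (ex_intro2 _ _ (ev @^-1` A) (cev A oA) erefl).
Qed.

End evaluation.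

(** * Tails of the normalized minimum *)

Section min_tail.
Context {R : realType} {n : nat} {d : measure_display} {T : measurableType d}.
Context {P : probability T R}.
Variables (C : nat -> {RV P >-> 'rV[R]_n}).
Hypothesis C_orthant : forall k w, orthant R n (C k w).
Hypothesis C_indep : independent_sequence C.

(** The minimum is at least t if and only if all the pairings are at least t
divided by the normalization, and these events are independent. *)
Lemma min_process_tail (alpha : R) (p : closed_simplex R n) (q : R -> R) K t :
  (forall k e, P [set w | pairing (\val p) (C k w) < e] = (q e)%:E) ->
  distribution P (min_process alpha C_orthant K)
    [set psi | t <= concave_fun psi p] =
  ((1 - q (t / K.+1%:R `^ (n%:R + alpha)^-1)) ^+ K.+1)%:E.
Proof.
move=> Cq; set s := _ `^ _; set e := t / s.
have s0 : 0 < s by exact: powR_gt0.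
pose A := [set x : 'rV[R]_n | e <= pairing (\val p) x].
have mA : measurable A.
  apply: measurable_fun_truth; apply: measurable_fun_ler => //.
  exact: measurable_pairing.
(* The index list is kept abstract: simplification would unfold it. *)
have [J JE] : {J | J = iota 0 K.+1} by exists (iota 0 K.+1).
have JP k : (k \in J) = (k < K.+1)%N by rewrite JE mem_iota.
have -> : distribution P (min_process alpha C_orthant K)
    [set psi | t <= concave_fun psi p] =
    P (\bigcap_(k in [set` J]) (C k @^-1` A)).
  rewrite /distribution /pushforward; congr (P _).
  apply/seteqP; split => [w /= tw k|w Aw /=].
    rewrite /= JP => kK.
    rewrite /A/= ler_pdivrMr// mulrC (le_trans tw)//.
    rewrite ler_wpM2l ?(ltW s0)//.
    exact: (@bigmin_le _ _ _ _ (Ordinal kK) (fun j => pairing (\val p) (C j w))).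
  have kA k : (k < K.+1)%N -> t <= s * pairing (\val p) (C k w).
    move=> kK; rewrite mulrC -ler_pdivrMr//; apply: (Aw k).
    by rewrite /= JP.
  change (t <= scaled_min s (C^~ w) K p).
  rewrite /scaled_min mulrC -ler_pdivrMr//; apply/bigmin_geP; split=> [|k _].
    by rewrite ler_pdivrMr// mulrC; exact: kA.
  by rewrite ler_pdivrMr// mulrC; exact: kA.
rewrite (C_indep (J := J) (A := fun=> A))//; last by rewrite JE iota_uniq.
rewrite (eq_bigr (fun=> (1 - q e)%:E)) => [|k _].
  rewrite big_const_seq count_predT JE size_iota.
  by elim: K.+1 (1 - q e) => // k IH x; rewrite iterS IH -EFinM exprS.
have -> : C k @^-1` A = ~` [set w | pairing (\val p) (C k w) < e].
  by apply/seteqP; split=> w /=; rewrite /A/= leNgt => /negP.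
rewrite probability_setC ?Cq//.
apply: measurable_fun_truth; apply: measurable_fun_ltr => //.
by apply: (measurableT_comp (measurable_pairing _)); exact: measurable_funP.
Qed.

End min_tail.

Section tail_limit.
Context {R : realType} {n : nat}.
Hypothesis n_ge2 : (2 <= n)%N.
Variables (alpha : R) (h rho : 'rV[R]_n -> R).
Hypothesis alpha_gt : - n%:R < alpha.
Context d0 (T0 : measurableType d0) (P0 : probability T0 R).
Variables (C : {RV P0 >-> 'rV[R]_n}).
Hypothesis C_orthant : forall w, orthant R n (C w).
Hypothesis C_density : joint_density C rho.
Hypothesis C_homogeneous : asymptotically_homogeneous rho alpha h.
Hypothesis h_hom : forall c x, 0 < c -> orthant R n x ->
  h (c *: x) = c `^ alpha * h x.
Context d1 (T1 : measurableType d1) (P1 : probability T1 R).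
Variables (Cs : nat -> {RV P1 >-> 'rV[R]_n}).
Hypothesis Cs_orthant : forall k w, orthant R n (Cs k w).
Hypothesis Cs_copies : forall k, same_distribution (Cs k) C.
Hypothesis Cs_independent : independent_sequence Cs.

(** Let q(e) be the probability that the pairing of p with C is less than e, and
c the integral of h over the region.  With eps K = t (K + 1)^(-1/b) one has
K + 1 = t^b (eps K)^(-b), so the small-ball limit says that (K + 1) q(eps K)
tends to c t^b. *)
Lemma cvg_min_process_tail (p : closed_simplex R n) (t : R) :
  orthant R n (\val p) -> 0 < t ->
  (lebesgue_row R n).-integrable (region (\val p) 1) (EFin \o h) ->
  distribution P1 (min_process alpha Cs_orthant K)
    [set psi | t <= concave_fun psi p] @[K --> \oo] -->
  (expR (- (fine (\int[lebesgue_row R n]_(x in region (\val p) 1) (h x)%:E)%E *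
    t `^ (n%:R + alpha))))%:E.
Proof.
move=> p0 t0 ih; set b := n%:R + alpha.
have b0 : 0 < b by rewrite /b -ltrBlDl sub0r.
set c := fine _.
have cE : (c%:E = \int[lebesgue_row R n]_(x in region (\val p) 1) (h x)%:E)%E.
  by rewrite /c fineK//; apply: integrable_fin_num => //; exact: measurable_region.
have [mrho rho0 C_rho] := C_density.
pose A e := [set x : 'rV[R]_n | pairing (\val p) x < e].
have mA e : measurable (A e).
  apply: measurable_fun_truth; apply: measurable_fun_ltr => //.
  exact: measurable_pairing.
pose q e := fine (distribution P0 C (A e)).
have qE e : distribution P0 C (A e) = (q e)%:E by rewrite fineK// fin_num_measure.
have q_rho e : (q e)%:E =
    (\int[lebesgue_row R n]_(x in region (\val p) e) (rho x)%:E)%E.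
  rewrite -qE -C_rho; last 2 first.
  - exact: measurable_region.
  - exact: region_sub_orthant.
  rewrite /distribution /pushforward; congr (P0 _).
  by apply/seteqP; split=> [w Aw|w []].
have q01 e : 0 <= q e <= 1.
  by rewrite fine_ge0//= -lee_fin -qE probability_le1.
pose eps (K : nat) := t / K.+1%:R `^ b^-1.
have eps0 K : 0 < eps K by rewrite divr_gt0// powR_gt0.
have cvg_eps : eps K @[K --> \oo] --> 0.
  rewrite -[X in _ --> X](mulr0 t); apply: cvgM; first exact: cvg_cst.
  rewrite (_ : (fun K => _) = fun K : nat => K.+1%:R^-1 `^ b^-1); last first.
    apply/funext => K.
    by rewrite -(powR_inv1 (ler0n _ _)) -powRrM mulN1r powRN.
  have bi0 : 0 < b^-1 by rewrite invr_gt0.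
  have /cvg_at_rightP := powR_cvg0 bi0.
  by apply; split => //; exact: cvg_harmonic.
have eps_pow K : eps K `^ (- b) = t `^ (- b) * K.+1%:R.
  rewrite /eps powRM ?invr_ge0 ?powR_ge0 ?(ltW t0)//; congr (_ * _).
  rewrite -[X in X `^ _]powR_inv1 ?powR_ge0// -!powRrM mulN1r opprK.
  by rewrite mulVf ?gt_eqF// powRr1.
have Nq : K.+1%:R * q (eps K) @[K --> \oo] --> c * t `^ b.
  have := cvg_integral_region_rho n_ge2 alpha_gt mrho rho0 C_homogeneous h_hom
    p0 ih eps0 cvg_eps.
  rewrite -cE (_ : (fun K => _) =
    (fun K => (eps K `^ (- b) * q (eps K))%:E)); last first.
    apply/funext => K.
    rewrite (@integral_region_shrink R n rho alpha mrho rho0 (\val p) (eps K))//.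
    by rewrite -q_rho EFinM.
  move=> /fine_cvg cvg_q.
  rewrite mulrC (_ : (fun K => _) =
    (fun K => t `^ b * (eps K `^ (- b) * q (eps K)))); last first.
    apply/funext => K; rewrite eps_pow mulrA mulrA -powRD ?(gt_eqF t0) ?implybT//.
    by rewrite subrr powRr0 mul1r.
  by apply: cvgM; [exact: cvg_cst|exact: cvg_q].
rewrite (_ : (fun K => _) = (fun K => ((1 - q (eps K)) ^+ K.+1)%:E)); last first.
  apply/funext => K; apply: min_process_tail => // k e.
  by rewrite -qE -(Cs_copies k).
apply: cvg_EFin; first exact: nearW.
by apply: cvg_onem_expr.
Qed.

End tail_limit.

(** * The mean of the limit *)

Section boundary.
Context {R : realType} {n : nat}.
Hypothesis n_ge2 : (2 <= n)%N.

(** The integral of a nonnegative function is a supremum over the simple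
functions below it, so it is monotone for arbitrary functions.  Evaluation at a
boundary point is compared in this way, without its measurability. *)
Lemma ge0_le_integralT d (T : measurableType d) (m : {measure set T -> \bar R})
    (f g : T -> \bar R) : (forall x, 0 <= f x)%E -> (forall x, f x <= g x)%E ->
  (\int[m]_x f x <= \int[m]_x g x)%E.
Proof.
move=> f0 fg; have g0 x : (0 <= g x)%E by exact: le_trans (fg x).
rewrite !ge0_integralTE//; apply: le_ereal_sup => _ [h hf <-].
by exists h => // x; exact: le_trans (fg x).
Qed.

Lemma simplex_interpolation (p : closed_simplex R n) (s : R) : 0 < s <= 1 ->
  exists b r : closed_simplex R n, [/\ \val b = barycenter R n,
    \val r = (1 - s) *: \val p + s *: \val b & orthant R n (\val r)].
Proof.
move=> /andP[s0 s1]; have n0 : (0 < n)%N by exact: ltnW.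
have n0' : n%:R != 0 :> R by rewrite pnatr_eq0 -lt0n.
have bar_sum : \sum_i barycenter R n ord0 i = 1.
  under eq_bigr do rewrite /barycenter mxE.
  by rewrite sumr_const card_ord -[LHS]mulr_natr mulVf.
have b0 := orthant_barycenter (R := R) n0.
have cb : closed_simplex R n (barycenter R n).
  by apply: subset_closure; exact: orthant_simplex.
pose r := (1 - s) *: \val p + s *: barycenter R n.
have r0 : orthant R n r.
  move=> i; rewrite !mxE ltr_wpDl ?mulr_gt0 ?invr_gt0 ?ltr0n//.
  by rewrite mulr_ge0 ?subr_ge0// closed_simplex_ge0.
have cr : closed_simplex R n r.
  apply: subset_closure; apply: orthant_simplex => //.
  under eq_bigr do rewrite mxE [X in X + _]mxE [X in _ + X]mxE.
  by rewrite big_split/= -!mulr_sumr bar_sum closed_simplex_sum !mulr1 subrK.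
by exists (SigSub (mem_set cb)), (SigSub (mem_set cr)).
Qed.

End boundary.

Lemma powR_prod (R : realType) (I : finType) (F : I -> R) (r : R) :
  (forall i, 0 <= F i) -> (\prod_i F i) `^ r = \prod_i F i `^ r.
Proof.
move=> F0; suff [] : 0 <= \prod_i F i /\ (\prod_i F i) `^ r = \prod_i F i `^ r by [].
apply: (big_rec2 (fun x y => 0 <= x /\ x `^ r = y)).
  by rewrite powR1.
by move=> i x y _ [x0 <-]; rewrite mulr_ge0// powRM.
Qed.

Section mean_limit.
Context {R : realType} {n : nat}.

Lemma mean_eq_limit_mean (mu : probability (borel (concave_space R n)) R)
    d2 (T2 : measurableType d2) (P2 : probability T2 R)
    (Psi : {RV P2 >-> borel (concave_space R n)}) (p : closed_simplex R n) :
  (forall A, measurable A -> distribution P2 Psi A = mu A) ->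
  simplex R n (\val p) ->
  ('E_P2[fun w => concave_fun (Psi w) p])%E =
  (\int[mu]_psi (concave_fun psi p)%:E)%E.
Proof.
move=> Psi_mu ps.
have mev : measurable_fun setT
    (fun psi : borel (concave_space R n) => (concave_fun psi p)%:E).
  apply/measurable_EFinP.
  exact: (measurable_borel_continuous (continuous_evaluation ps)).
rewrite unlock.
transitivity (\int[distribution P2 Psi]_psi (concave_fun psi p)%:E)%E.
  by rewrite ge0_integral_distribution// => psi; rewrite lee_fin concave_fun_ge0.
by apply: eq_measure_integral => A mA _; exact: Psi_mu.
Qed.

(** Concavity and nonnegativity give (1 - s) psi(p) <= psi(r). *)
Lemma mean_concave_le d2 (T2 : measurableType d2) (P2 : probability T2 R)
    (Psi : {RV P2 >-> borel (concave_space R n)}) (p b r : closed_simplex R n)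
    (s : R) :
  0 <= s < 1 -> \val r = (1 - s) *: \val p + s *: \val b ->
  simplex R n (\val r) ->
  ('E_P2[fun w => concave_fun (Psi w) p] <=
   (1 - s)^-1%:E * 'E_P2[fun w => concave_fun (Psi w) r])%E.
Proof.
move=> /andP[s0 s1] rE rs; rewrite unlock.
have t0 : 0 < 1 - s by rewrite subr_gt0.
rewrite -ge0_integralZl_EFin; last 4 first.
- by [].
- by move=> w _; rewrite lee_fin concave_fun_ge0.
- apply/measurable_EFinP.
  apply: (measurableT_comp (measurable_borel_continuous (continuous_evaluation rs))).
  exact: measurable_funP.
- by rewrite invr_ge0 ltW.
apply: ge0_le_integralT => w; first by rewrite lee_fin concave_fun_ge0.
rewrite -EFinM lee_fin mulrC ler_pdivlMr// mulrC.
have [_ conc _] := concave_fun_concave_set (Psi w).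
have : 0 <= 1 - s <= 1 by rewrite (ltW t0) gerBl.
rewrite -[in X in _ + X *: _](subKr 1 s) in rE.
move=> /(conc p b r (1 - s)) /(_ rE); apply: le_trans.
by rewrite lerDl subKr mulr_ge0// concave_fun_ge0.
Qed.

End mean_limit.

Theorem proposition4p4 (R : realType) (n : nat) (n_ge2 : (2 <= n)%N)
  (alpha gamma : R) (a : 'I_n -> R)
  (gamma_gt0 : 0 < gamma) (a_gtN1 : forall i, -1 < a i)
  (h : 'rV[R]_n -> R)
  (hE : forall x, orthant R n x -> h x = gamma * \prod_i x ord0 i `^ a i)
  (d0 : measure_display) (T0 : measurableType d0) (P0 : probability T0 R)
  (C : {RV P0 >-> 'rV[R]_n}) (C_orthant : forall w, orthant R n (C w))
  (rho : 'rV[R]_n -> R) (C_density : joint_density C rho)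
  (C_homogeneous : asymptotically_homogeneous rho alpha h)
  (d1 : measure_display) (T1 : measurableType d1) (P1 : probability T1 R)
  (Cs : nat -> {RV P1 >-> 'rV[R]_n})
  (Cs_orthant : forall k w, orthant R n (Cs k w))
  (Cs_copies : forall k, same_distribution (Cs k) C)
  (Cs_independent : independent_sequence Cs)
  (mu : probability (borel (concave_space R n)) R)
  (mu_limit : weakly_converges
    (fun K => distribution P1 (min_process alpha Cs_orthant K)) mu)
  (d2 : measure_display) (T2 : measurableType d2) (P2 : probability T2 R)
  (Psi : {RV P2 >-> borel (concave_space R n)})
  (Psi_mu : forall A, measurable A -> distribution P2 Psi A = mu A) :
  let pi_ i := (1 + a i) / (n%:R + alpha) in
  let M := (\int[lebesgue_row R n]_(y in region (barycenter R n) n%:R^-1)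
              (h y)%:E)%E in
  let L := Gamma ((n%:R + alpha)^-1 + 1) / fine M `^ (n%:R + alpha)^-1 in
  [/\ alpha = \sum_i a i,
      simplex R n (\row_i pi_ i),
      (0 < M < +oo)%E &
      forall p : closed_simplex R n,
        ('E_P2[fun w => concave_fun (Psi w) p])%E =
        (L * \prod_i (\val p) ord0 i `^ pi_ i)%:E].
Proof.
move=> pi_ M L.
have n0 : (0 < n)%N by exact: ltnW.
have alphaE := homogeneity_exponent gamma_gt0 hE C_homogeneous.
have a1 i : 0 < 1 + a i by rewrite addrC -ltrBlDr sub0r.
have bE : n%:R + alpha = \sum_i (1 + a i).
  by rewrite big_split/= sumr_const card_ord alphaE.
have b0 : 0 < n%:R + alpha.
  rewrite bE (bigD1 (Ordinal n0))//= ltr_pwDl// sumr_ge0// => i _; exact: ltW.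
have alpha_gt : - n%:R < alpha by rewrite -subr_gt0 opprK addrC.
set b := n%:R + alpha in pi_ L b0 bE *.
have pi0 i : 0 < pi_ i by rewrite divr_gt0.
have Mbd := power_law_mass_bounds gamma_gt0 a_gtN1 hE n0.
have fM : 0 < fine M by apply: fine_gt0.
have ME : M = (fine M)%:E by rewrite fineK// gt0_fin_numE//; case/andP : Mbd.
have L0 : 0 <= L.
  rewrite divr_ge0 ?powR_ge0// /Gamma /Rintegral fine_ge0//.
  by apply: integral_ge0 => t _; rewrite lee_fin mulr_ge0 ?powR_ge0 ?expR_ge0.
have h_hom c x : 0 < c -> orthant R n x -> h (c *: x) = c `^ alpha * h x.
  by move=> c0 x0; rewrite alphaE; exact: (power_law_homogeneous hE).
split.
- exact: alphaE.
- apply: orthant_simplex => //; first by move=> i; rewrite mxE.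
  under eq_bigr do rewrite mxE.
  by rewrite -mulr_suml -bE divff// gt_eqF.
- exact: Mbd.
have interior p : orthant R n (\val p) ->
    ('E_P2[fun w => concave_fun (Psi w) p])%E =
    (L * \prod_i (\val p) ord0 i `^ pi_ i)%:E.
  move=> p0; have ps := orthant_simplex n_ge2 p0 (closed_simplex_sum p).
  rewrite (mean_eq_limit_mean Psi_mu ps).
  have ih := integrable_region_power_law a_gtN1 hE 1 p0.
  rewrite (weak_limit_mean mu_limit (continuous_evaluation ps)
    (fun psi => concave_fun_ge0 psi p) (fun t t0 =>
      cvg_min_process_tail n_ge2 alpha_gt C_orthant C_density C_homogeneous
       h_hom Cs_orthant Cs_copies Cs_independent p0 t0 ih)).
  rewrite (integral_region_power_law gamma_gt0 a_gtN1 hE n0 p0) -/M ME -EFinM/=.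
  set c := _ * fine M.
  have prod0 : 0 < \prod_i (\val p) ord0 i `^ (- (1 + a i)).
    by rewrite prodr_gt0// => i _; exact: powR_gt0.
  have c0 : 0 < c by rewrite mulr_gt0.
  rewrite integral_expR_powR//; congr EFin.
  have -> : c `^ b^-1 = (\prod_i (\val p) ord0 i `^ pi_ i)^-1 * fine M `^ b^-1.
    rewrite /c powRM ?(ltW prod0) ?(ltW fM)//; congr (_ * _).
    rewrite powR_prod => [|i]; last exact: powR_ge0.
    rewrite -prodfV; apply: eq_bigr => i _.
    by rewrite -powRrM mulNr powRN.
  by rewrite invfM invrK mulrA mulrAC.
move=> p.
case: (pselect (orthant R n (\val p))) => [|/existsNP[i pi_le0]].
  exact: interior.
have pi_eq0 : (\val p) ord0 i = 0.
  apply/eqP; rewrite eq_le closed_simplex_ge0 andbT leNgt; exact/negP.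
rewrite (bigD1 i)//= pi_eq0 powR0 ?gt_eqF// mul0r mulr0.
apply/eqP; rewrite eq_le; apply/andP; split; last first.
  rewrite unlock; apply: integral_ge0 => w _.
  by rewrite lee_fin concave_fun_ge0.
(* At distance s = 1 / (k + 2) from the boundary point, concavity costs a factor
   (1 - s)^-1 <= 2, the i-th coordinate is at most s and the others at most 1. *)
have u_lim : (2 * L * k.+2%:R^-1 `^ pi_ i)%:E @[k --> \oo] --> 0%E.
  apply: cvg_EFin; first exact: nearW.
  rewrite -[X in _ --> X](mulr0 (2 * L)); apply: cvgM; first exact: cvg_cst.
  have /cvg_at_rightP := powR_cvg0 (pi0 i); apply; split.
    by move=> k; rewrite invr_gt0.
  by have := @cvg_harmonic R; rewrite -cvg_shiftS.
apply: (@le_trans _ _ (limn (fun k => (2 * L * k.+2%:R^-1 `^ pi_ i)%:E))); last first.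
  by rewrite (cvg_lim _ u_lim).
apply: lime_ge.
  by apply/cvg_ex; eexists; exact: u_lim.
apply: nearW => k; set s := k.+2%:R^-1.
have s0 : 0 < s by rewrite invr_gt0.
have s2 : s <= 2^-1 by rewrite lef_pV2 ?posrE// ler_nat.
have s1 : s < 1 by rewrite (le_lt_trans s2)// invf_lt1// ltr1n.
have s01 : 0 < s <= 1 by rewrite s0 ltW.
have [c [r [cE rE r0]]] := simplex_interpolation n_ge2 p s01.
have rs := orthant_simplex n_ge2 r0 (closed_simplex_sum r).
apply: le_trans (mean_concave_le _ _ rE rs) _; first by rewrite ltW.
rewrite interior// -EFinM lee_fin mulrA ler_pM//.
- by rewrite mulr_ge0// invr_ge0 subr_ge0 ltW.
- by apply: prodr_ge0 => j _; exact: powR_ge0.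
- rewrite ler_wpM2r// -[leRHS]invrK lef_pV2 ?posrE ?subr_gt0//; lra.
rewrite (bigD1 i)//= -[leRHS]mulr1 ler_pM ?powR_ge0//.
- by apply: prodr_ge0 => j _; exact: powR_ge0.
- apply: ge0_ler_powR; rewrite ?nnegrE; [exact: ltW|exact: ltW|exact: ltW|].
  rewrite rE !mxE pi_eq0 mulr0 add0r cE /barycenter mxE -[leRHS]mulr1.
  rewrite ler_wpM2l ?(ltW s0)//.
  by rewrite invf_le1 ?ltr0n// ler1n.
apply: prodr_ile1 => j _; rewrite powR_ge0/=.
have [/(_ j)/andP[rj0 rj1] _] := rs.
rewrite [leRHS](_ : 1 = 1 `^ pi_ j); last by rewrite powR1.
by apply: ge0_ler_powR; rewrite ?nnegrE// ltW.
Qed.
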